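(* Fix $p\ge 1$. Let $\ell(d):=d^p$, $F:=U_1$ and $a:=1/p$. For $n\ge 1$ let $\mathsf{D}_{\mathrm{ET},n}:=\mathrm{ET}^{a}$, where $\mathrm{ET}$ is the Entropy-Transport cost induced by $F_n:=nU_1$ and $c=\ell(d)=d^p$, and let $$\mathbf{D}_{\mathrm{ET},n}\big((X_1,d_1,\mu_1),(X_2,d_2,\mu_2)\big):=\inf\ \mathsf{D}_{\mathrm{ET},n}(\psi^1_\sharp\mu_1,\psi^2_\sharp\mu_2),$$ where the infimum is over all complete and separable metric spaces $(\hat X,\hat d)$ with isometric embeddings $\psi^i:\mathsf{supp}(\mu_i)\to\hat X$, $i=1,2$. Then, for all metric measure spaces $(X_1,d_1,\mu_1),(X_2,d_2,\mu_2)\in\mathbf{X}$, the limit $$\mathcal{D}_p\big((X_1,d_1,\mu_1),(X_2,d_2,\mu_2)\big):=\lim_{n\to\infty}\mathbf{D}_{\mathrm{ET},n}\big((X_1,d_1,\mu_1),(X_2,d_2,\mu_2)\big)$$ is well defined. Moreover, for all $(X_1,d_1,\mu_1),(X_2,d_2,\mu_2)\in\mathbf{X}_{1,p}$ we have $$\mathcal{D}_p\big((X_1,d_1,\mu_1),(X_2,d_2,\mu_2)\big)=\mathbf{D}_p\big((X_1,d_1,\mu_1),(X_2,d_2,\mu_2)\big).$$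
   Context: For a complete separable metric space $X$, $\mathscr{M}(X)$ denotes the set of finite nonnegative Borel measures on $X$. For a superlinear convex lower semicontinuous $F:[0,\infty)\to[0,\infty]$ with $F(1)=0$ (superlinear: $F(s)/s\to\infty$ as $s\to\infty$), the $F$-divergence is $D_F(\gamma\|\mu):=\int_X F(\frac{d\gamma}{d\mu})\,d\mu$ if $\gamma\ll\mu$ and $+\infty$ otherwise. The Entropy-Transport cost induced by $F$ and a lower semicontinuous cost $c:X\times X\to[0,\infty]$ is $$\mathrm{ET}(\mu_1,\mu_2):=\inf_{\gamma\in\mathscr{M}(X\times X)}\Big\{D_F(\gamma_1\|\mu_1)+D_F(\gamma_2\|\mu_2)+\int_{X\times X} c\,d\gamma\Big\},$$ where $\gamma_i=(\pi^i)_\sharp\gamma$ are the marginals of $\gamma$. Set $U_1(s):=s\log s-s+1$. A metric measure space is a triple $(X,d,\mu)$ with $(X,d)$ a complete separable metric space and $\mu\in\mathscr{M}(X)$; $\mathsf{supp}(\mu)$ is the support of $\mu$. Two metric measure spaces are isomorphic if there is an isometry $\psi:\mathsf{supp}(\mu_1)\to\mathsf{supp}(\mu_2)$ with $\psi_\sharp\mu_1=\mu_2$. $\mathbf{X}$ is the family of isomorphism classes, and $\mathbf{X}_{1,p}$ is the subset of those $(X,d,\mu)\in\mathbf{X}$ for which $\mu$ is a probability measure with finite $p$-moment. The limit $\mathcal{D}_p$ is understood in $[0,+\infty]$. Sturm's distance: $\mathbf{D}_p\big((X_1,d_1,\mu_1),(X_2,d_2,\mu_2)\big):=\inf\mathcal{W}_p(\psi^1_\sharp\mu_1,\psi^2_\sharp\mu_2)$,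 the infimum over all complete separable metric spaces $(\hat X,\hat d)$ with isometric embeddings $\psi^i:\mathsf{supp}(\mu_i)\to\hat X$, $i=1,2$, where $\mathcal{W}_p$ is the $p$-Wasserstein distance, $\mathcal{W}_p^p(\mu,\nu)=\inf_\gamma\int\hat d^p\,d\gamma$ over $\gamma\in\mathscr{M}(\hat X\times\hat X)$ with marginals $\mu,\nu$. *)

(* Defs.v *)
From HB Require Import structures.
From mathcomp Require Import all_boot all_order all_algebra.
From mathcomp Require Import all_classical all_reals all_analysis.

Set Implicit Arguments.
Unset Strict Implicit.
Unset Printing Implicit Defensive.

Import Order.TTheory GRing.Theory Num.Theory.
Import numFieldNormedType.Exports.

Local Open Scope classical_set_scope.
Local Open Scope ring_scope.

HB.mixin Record isSeparable T & Topological T := {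
  separable_subproof : exists2 D : set T, countable D & dense D }.

(* MathComp-Analysis only builds sigma-algebras and complete spaces on pointed
   types, so these spaces are nonempty. *)
#[short(type="polishMetricType")]
HB.structure Definition PolishMetric (R : realType) :=
  { T of Metric R T & Complete T & isSeparable T }.

Notation borel T := (g_sigma_algebraType (@open T)).

Section borel_maps.
Context (R : realType) (X : polishMetricType R).

Lemma measurable_fst_borel :
  measurable_fun [set: borel (X * X)%type] (fst : borel (X * X)%type -> borel X).
Proof.
apply: measurability => // _ [B oB <-]; rewrite setTI.
by apply: sub_sigma_algebra; apply: open_comp => // x _; exact: cvg_fst.
Qed.

Lemma measurable_snd_borel :
  measurable_fun [set: borel (X * X)%type] (snd : borel (X * X)%type -> borel X).
Proof.
apply: measurability => // _ [B oB <-]; rewrite setTI.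
by apply: sub_sigma_algebra; apply: open_comp => // x _; exact: cvg_snd.
Qed.

Context (g : {finite_measure set borel (X * X)%type -> \bar R}).

Definition marg1 : set (borel X) -> \bar R :=
  pushforward g (fst : borel (X * X)%type -> borel X).
Definition marg2 : set (borel X) -> \bar R :=
  pushforward g (snd : borel (X * X)%type -> borel X).


Let marg1_meas : {measure set borel X -> \bar R}.
Proof.
refine (pushforward g (fst : borel (X * X)%type -> borel X)).
exact: measurable_fst_borel.
Defined.

Let marg2_meas : {measure set borel X -> \bar R}.
Proof.
refine (pushforward g (snd : borel (X * X)%type -> borel X)).
exact: measurable_snd_borel.
Defined.

HB.instance Definition _ := isMeasure.Build _ _ _ marg1
  (measure0 marg1_meas) (@measure_ge0 _ _ _ marg1_meas)
  (@measure_semi_sigma_additive _ _ _ marg1_meas).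

HB.instance Definition _ := isMeasure.Build _ _ _ marg2
  (measure0 marg2_meas) (@measure_ge0 _ _ _ marg2_meas)
  (@measure_semi_sigma_additive _ _ _ marg2_meas).

Let marg1_fin : fin_num_fun marg1.
Proof.
move=> A mA; apply: fin_num_measure.
by rewrite -[X in measurable X]setTI; exact: measurable_fst_borel.
Qed.

Let marg2_fin : fin_num_fun marg2.
Proof.
move=> A mA; apply: fin_num_measure.
by rewrite -[X in measurable X]setTI; exact: measurable_snd_borel.
Qed.

HB.instance Definition _ := Measure_isFinite.Build _ _ _ marg1 marg1_fin.
HB.instance Definition _ := Measure_isFinite.Build _ _ _ marg2 marg2_fin.
End borel_maps.

Section entropy_transport.
Context (R : realType).
Local Open Scope ereal_scope.

(* The library's nonnegative Radon-Nikodym derivative of a finite measure with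
   respect to a sigma-finite one; it takes finite values in [0, +oo) everywhere
   when g `<< mu, so that F is only evaluated on [0, +oo). *)
Definition F_divergence d (T : measurableType d) (F : R -> \bar R)
    (g mu : {finite_measure set T -> \bar R}) : \bar R :=
  if `[< g `<< mu >]
  then \int[mu]_x F (fine (Radon_Nikodym_SigmaFinite.f g mu x))
  else +oo.

Definition entropy_transport (X : polishMetricType R) (F : R -> \bar R)
    (c : X -> X -> \bar R) (mu1 mu2 : {finite_measure set borel X -> \bar R}) :=
  ereal_inf [set F_divergence F (marg1 g) mu1 + F_divergence F (marg2 g) mu2
                 + \int[g]_z c z.1 z.2
            | g in [set: {finite_measure set borel (X * X)%type -> \bar R}]].

(* ln 0 = 0 in the library, so U1 0 = 1. *)
Definition U1 (s : R) : R := (s * ln s - s + 1)%R.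

Definition dist_pow (X : polishMetricType R) (p : R) (x y : X) : \bar R :=
  (mdist x y `^ p)%:E.

Definition coupling (X : polishMetricType R)
    (mu1 mu2 : {finite_measure set borel X -> \bar R}) :=
  [set g : {finite_measure set borel (X * X)%type -> \bar R} |
    forall A : set (borel X), measurable A ->
      marg1 g A = mu1 A /\ marg2 g A = mu2 A].

Definition wasserstein (X : polishMetricType R) (p : R)
    (mu1 mu2 : {finite_measure set borel X -> \bar R}) : \bar R :=
  ereal_inf [set \int[g]_z dist_pow p z.1 z.2 | g in coupling mu1 mu2]
    `^ p^-1.

End entropy_transport.

Section support.
Context (R : realType) (X : polishMetricType R).
Context (mu : {finite_measure set borel X -> \bar R}).

Definition supp : set X :=
  [set x | forall U : set X, open U -> U x -> (0 < mu U)%E].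

Lemma supp_closed : closed supp.
Proof.
move=> x clx U oU Ux.
have [y [sy Uy]] : supp `&` U !=set0 by apply: clx; exact: open_nbhs_nbhs.
exact: sy.
Qed.

End support.

Section isometric_embedding.
Context (R : realType) (X Y : polishMetricType R).

Record isometric_embedding (A : set X) := IsometricEmbedding {
  embedding_fun :> A -> Y ;
  embedding_isometry : forall x y : A,
    mdist (embedding_fun x) (embedding_fun y) = mdist (set_val x) (set_val y) }.

Lemma measurable_embedding (A : set X) (psi : isometric_embedding A)
    (B : set (borel Y)) : closed A -> measurable B ->
  measurable (set_val @` (psi @^-1` B) : set (borel X)).
Proof.
move=> cA.
have mA : measurable (A : set (borel X)).
  rewrite -[A]setCK; apply: measurableC; apply: sub_sigma_algebra.
  exact: closed_openC.
have imE C : set_val @` (psi @^-1` ~` C) = A `\` (set_val @` (psi @^-1` C)).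
  apply/seteqP; split=> [_ [x nCx <-]|x [Ax nCx]].
    split; first exact: set_valP.
    move=> [y Cy] /val_inj yx; apply: nCx; by rewrite /preimage/= -yx.
  exists (SigSub (mem_set Ax)) => // Cx; apply: nCx.
  by exists (SigSub (mem_set Ax)).
pose G := [set C : set Y | measurable (set_val @` (psi @^-1` C) : set (borel X))].
suff sG : <<s open >> `<=` G by move=> mB; exact: sG.
apply: smallest_sub.
- split.
  + by rewrite /G/= preimage_set0 image_set0; exact: measurable0.
  + move=> C GC; rewrite /G/= setTD imE; exact: measurableD.
  + move=> F GF; rewrite /G/= preimage_bigcup image_bigcup.
    by apply: bigcup_measurable => i _; exact: GF.
- move=> C oC; rewrite /G/=.
  have -> : set_val @` (psi @^-1` C) =
      A `&` \bigcup_(W in [set W | open W /\ forall x : A, W (set_val x) -> C (psi x)]) W.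
    apply/seteqP; split=> [_ [x Cx <-]|x [Ax [W [oW WC] Wx]]].
      split; first exact: set_valP.
      have /nbhs_ballP[e /= e0 eC] : nbhs (psi x) C.
        exact: open_nbhs_nbhs.
      exists ((ball (set_val x) e)^°%classic).
        split; first exact: open_interior.
        move=> y /interior_subset; rewrite ballEmdist/= => xy; apply: eC.
        by rewrite ballEmdist/= embedding_isometry.
      by apply: nbhs_singleton; apply: nbhs_interior; exact: nbhsx_ballx.
    exists (SigSub (mem_set Ax)) => //.
    exact: WC.
  apply: measurableI => //; apply: sub_sigma_algebra.
  by apply: bigcup_open => W [].
Qed.

End isometric_embedding.

Section support_pushforward.
Context (R : realType) (X Y : polishMetricType R).
Context (mu : {finite_measure set borel X -> \bar R}).
Context (psi : isometric_embedding Y (supp mu)).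

(* The image under psi of the restriction of mu to its support, on which mu is
   concentrated since X is separable. *)
Definition supp_pushforward : set (borel Y) -> \bar R :=
  fun B => mu (set_val @` (psi @^-1` B)).

Let mpre (B : set (borel Y)) : measurable B ->
  measurable (set_val @` (psi @^-1` B) : set (borel X)).
Proof. by apply: measurable_embedding; exact: supp_closed. Qed.

Let push0 : supp_pushforward set0 = 0%E.
Proof. by rewrite /supp_pushforward preimage_set0 image_set0 measure0. Qed.

Let push_ge0 B : (0 <= supp_pushforward B)%E.
Proof. exact: measure_ge0. Qed.

Let push_sigma_additive : semi_sigma_additive supp_pushforward.
Proof.
move=> F mF tF mUF; rewrite /supp_pushforward preimage_bigcup image_bigcup.
apply: measure_semi_sigma_additive.
- by move=> n; exact: mpre.
- apply/trivIsetP => i j _ _ ij; apply/seteqP; split=> // _ [[x Fx <-] [y Fy]].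
  move=> /val_inj yx; move: Fy; rewrite yx => Fy.
  by move/trivIsetP : tF => /(_ _ _ I I ij)/seteqP[+ _]; apply; split; [exact: Fx|].
- by rewrite -image_bigcup -preimage_bigcup; exact: mpre.
Qed.

HB.instance Definition _ := isMeasure.Build _ _ _ supp_pushforward
  push0 push_ge0 push_sigma_additive.

Let push_fin : fin_num_fun supp_pushforward.
Proof. by move=> B mB; apply: fin_num_measure; exact: mpre. Qed.

HB.instance Definition _ :=
  Measure_isFinite.Build _ _ _ supp_pushforward push_fin.

End support_pushforward.

(* Representatives; the isomorphism classes are those of mm_isomorphic. *)
Record mmspace (R : realType) := MMSpace {
  mm_space :> polishMetricType R ;
  mm_measure : {finite_measure set borel mm_space -> \bar R} }.

Section metric_measure_spaces.
Context (R : realType).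
Implicit Types M : mmspace R.
Local Open Scope ereal_scope.

(* range psi = supp makes psi an isometry of one support onto the other. *)
Definition mm_isomorphic M1 M2 :=
  exists psi : isometric_embedding M2 (supp (mm_measure M1)),
    range psi = supp (mm_measure M2) /\
    forall B : set (borel M2), measurable B ->
      supp_pushforward psi B = mm_measure M2 B.

Definition mm_prob_moment (p : R) M :=
  mm_measure M setT = 1 /\
  exists x0 : M, \int[mm_measure M]_x dist_pow p (x : M) x0 < +oo.

Definition sturm_distance (p : R) M1 M2 : \bar R :=
  ereal_inf [set r | exists (Y : polishMetricType R)
    (psi1 : isometric_embedding Y (supp (mm_measure M1)))
    (psi2 : isometric_embedding Y (supp (mm_measure M2))),
    r = wasserstein p (supp_pushforward psi1) (supp_pushforward psi2)].

Definition ET_distance (p : R) (n : nat) (X : polishMetricType R)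
    (mu1 mu2 : {finite_measure set borel X -> \bar R}) : \bar R :=
  entropy_transport (fun s => (n%:R * U1 s)%:E) (@dist_pow R X p) mu1 mu2
    `^ p^-1.

Definition sturm_ET_distance (p : R) (n : nat) M1 M2 : \bar R :=
  ereal_inf [set r | exists (Y : polishMetricType R)
    (psi1 : isometric_embedding Y (supp (mm_measure M1)))
    (psi2 : isometric_embedding Y (supp (mm_measure M2))),
    r = ET_distance p n (supp_pushforward psi1) (supp_pushforward psi2)].

Definition limit_ET_distance (p : R) M1 M2 : \bar R :=
  limn (fun n => sturm_ET_distance p n M1 M2).

End metric_measure_spaces.

(* Main.v *)
(* Monotonicity in n follows from U1 >= 0. A coupling of the two measures has
   entropy 0, so the limit is at most Sturm's distance. Conversely, let g be a
   plan whose total cost is less than C for a large n. The marginals of g have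
   entropy at most C / n, hence are close to mu1 and mu2 in total variation.
   Multiplying g by min(1, 1 / f1(x)) min(1, 1 / f2(y)), where f1 and f2 are the
   densities of its marginals, gives gt <= g with marginals below mu1 and mu2 and
   small missing mass; adding a coupling s of the missing marginals yields a
   genuine coupling. The cost of s is small uniformly in the ambient space: fix
   a, b in the two supports; then d(x, y) <= d(x, a) + d(a, b) + d(b, y), the
   p-moments of mu1 and mu2 at a and b do not depend on the embeddings and are
   uniformly integrable, and d(a, b) is bounded by integrating the triangle
   inequality against gt, which has mass at least 1/2. *)

From HB Require Import structures.
Require Import Defs.
From mathcomp Require Import all_boot all_order all_algebra.
From mathcomp Require Import all_classical all_reals all_analysis.
From mathcomp Require Import measurable_realfun.
From mathcomp Require Import ring lra.

Set Implicit Arguments.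
Unset Strict Implicit.
Unset Printing Implicit Defensive.

Import Order.TTheory GRing.Theory Num.Theory.
Import numFieldNormedType.Exports.

Local Open Scope classical_set_scope.
Local Open Scope ring_scope.

(** * Finite measures, densities and entropy *)

Section finite_measures.
Context d (T : measurableType d) (R : realType).
Local Open Scope ereal_scope.
Implicit Types mu nu : {finite_measure set T -> \bar R}.

Lemma finite_measure_of_fun (m : set T -> \bar R) :
  m set0 = 0 -> (forall A, 0 <= m A) -> semi_sigma_additive m ->
  fin_num_fun m ->
  exists nu : {finite_measure set T -> \bar R}, forall A, nu A = m A.
Proof.
move=> m0 mge0 mS mfin.
pose m' := isMeasure.Build _ _ _ m m0 mge0 mS.
pose M : {measure set T -> \bar R} := HB.pack m m'.
pose f' := Measure_isFinite.Build _ _ _ M mfin.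
pose F : {finite_measure set T -> \bar R} := HB.pack m m' f'.
by exists F.
Qed.

Lemma finite_measure_of_density mu (h : T -> R) :
  measurable_fun [set: T] h -> (forall x, (0 <= h x <= 1)%R) ->
  exists nu : {finite_measure set T -> \bar R},
    forall A, nu A = \int[mu]_(x in A) (h x)%:E.
Proof.
move=> mh h01; apply: finite_measure_of_fun.
- by rewrite integral_set0.
- by move=> A; apply: integral_ge0 => x _; rewrite lee_fin; case/andP: (h01 x).
- apply: semi_sigma_additive_nng_induced; first exact/measurable_EFinP.
  by move=> x; rewrite lee_fin; case/andP: (h01 x).
- move=> A mA; rewrite ge0_fin_numE; last first.
    by apply: integral_ge0 => x _; rewrite lee_fin; case/andP: (h01 x).
  apply: (@le_lt_trans _ _ (\int[mu]_(x in A) cst 1 x)).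
    apply: ge0_le_integral => //.
    + by move=> x _; rewrite lee_fin; case/andP: (h01 x).
    + exact/measurable_funTS/measurable_EFinP.
    + by move=> x _; rewrite lee_fin; case/andP: (h01 x).
  by rewrite integral_cst// mul1e -ge0_fin_numE// fin_num_measure.
Qed.

Lemma measure_complement mu nu :
  (forall A, measurable A -> nu A <= mu A) ->
  exists rho : {finite_measure set T -> \bar R},
    forall A, measurable A -> nu A + rho A = mu A.
Proof.
move=> numu.
pose D := cadd (charge_of_finite_measure mu)
  (copp (charge_of_finite_measure nu)).
have DE A : D A = mu A - nu A by [].
(* The difference has a sign only on measurable sets; setting it to 0 elsewhere gives nonnegativity
   on every set, as [finite_measure_of_fun] asks. *)
pose m A := if `[< measurable A >] then D A else 0.
have mE A : measurable A -> m A = D A by move=> mA; rewrite /m asboolT.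
have [rho rhoE] : exists rho : {finite_measure set T -> \bar R},
    forall A, rho A = m A.
  apply: finite_measure_of_fun.
  - by rewrite mE//; exact: charge0.
  - move=> A; rewrite /m; case: asboolP => // mA.
    by rewrite DE sube_ge0 ?numu// fin_num_measure.
  - move=> F mF tF mUF; rewrite mE//.
    rewrite [X in X @ _ --> _](_ : _ = fun n => \sum_(0 <= i < n) D (F i)).
      exact: charge_semi_sigma_additive.
    by apply/funext => n; apply: eq_bigr => i _; rewrite mE.
  - by move=> A mA; rewrite mE//; exact: fin_num_measure.
exists rho => A mA; rewrite rhoE mE// DE addeC subeK//.
exact: fin_num_measure.
Qed.

End finite_measures.

(** * Almost everywhere uniqueness of densities, and its consequences for the divergence *)

Section radon_nikodym_uniqueness.
Context d (T : measurableType d) (R : realType).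
Local Open Scope ereal_scope.
Implicit Types mu nu : {finite_measure set T -> \bar R}.
Local Notation "'d nu '/d mu" := (Radon_Nikodym_SigmaFinite.f nu mu).

Lemma measurable_Radon_Nikodym_SigmaFinite nu mu : nu `<< mu ->
  measurable_fun [set: T] ('d nu '/d mu).
Proof.
by move=> h; exact: measurable_int (Radon_Nikodym_SigmaFinite.f_integrable h).
Qed.

Lemma Radon_Nikodym_SigmaFinite_unique nu mu (g : T -> \bar R) : nu `<< mu ->
  measurable_fun [set: T] g ->
  (forall A, measurable A -> \int[mu]_(x in A) g x = nu A) ->
  ae_eq mu [set: T] ('d nu '/d mu) g.
Proof.
move=> numu mg gE; apply: integral_ae_eq => //.
  exact: Radon_Nikodym_SigmaFinite.f_integrable.
by move=> A _ mA; rewrite gE// -Radon_Nikodym_SigmaFinite.f_integral.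
Qed.

Lemma ge0_integral_comp_ae_eq mu (f g : T -> \bar R) (F : R -> \bar R) :
  (forall s, (0 <= s)%R -> 0 <= F s) ->
  measurable_fun setT F ->
  measurable_fun setT f -> measurable_fun setT g ->
  (forall x, 0 <= f x) -> (forall x, 0 <= g x) ->
  ae_eq mu setT f g ->
  \int[mu]_x F (fine (f x)) = \int[mu]_x F (fine (g x)).
Proof.
move=> F0 mF mf mg f0 g0 fg; apply: ge0_ae_eq_integral => //.
- by apply: measurableT_comp => //; apply: measurableT_comp.
- by apply: measurableT_comp => //; apply: measurableT_comp.
- by move=> x _; apply: F0; apply: fine_ge0.
- by move=> x _; apply: F0; apply: fine_ge0.
- exact: (ae_eq_comp (fun y => F (fine y))).
Qed.

(** The chosen density depends on the reference measure as a term, and agreement on measurable sets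
    is weaker than equality of terms. Almost everywhere uniqueness relates the two densities. *)
Lemma eq_F_divergence (F : R -> \bar R) nu mu mu' :
  (forall s, (0 <= s)%R -> 0 <= F s) -> measurable_fun setT F ->
  (forall A, measurable A -> mu A = mu' A) ->
  F_divergence F nu mu = F_divergence F nu mu'.
Proof.
move=> F0 mF mumu'; rewrite /F_divergence.
have domE : `[< nu `<< mu >] = `[< nu `<< mu' >].
  apply/asbool_equiv_eq; rewrite !null_content_dominatesP.
  split=> h A mA muA; apply: h => //; first exact: etrans (mumu' _ mA) muA.
  exact: etrans (esym (mumu' _ mA)) muA.
rewrite -domE; case: asboolP => // numu.
have numu' : nu `<< mu' by apply/asboolP; rewrite -domE; exact/asboolP.
transitivity (\int[mu]_x F (fine (Radon_Nikodym_SigmaFinite.f nu mu' x)));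
  last by apply: eq_measure_integral => A mA _; exact: mumu'.
apply: ge0_integral_comp_ae_eq => //.
- exact: measurable_Radon_Nikodym_SigmaFinite.
- exact: measurable_Radon_Nikodym_SigmaFinite.
- exact: Radon_Nikodym_SigmaFinite.f_ge0.
- exact: Radon_Nikodym_SigmaFinite.f_ge0.
- apply: Radon_Nikodym_SigmaFinite_unique => //.
    exact: measurable_Radon_Nikodym_SigmaFinite.
  move=> A mA; rewrite (@Radon_Nikodym_SigmaFinite.f_integral _ _ _ nu mu')//.
  by apply: eq_measure_integral => B mB _; exact: mumu'.
Qed.

(** The constant 1 is a density here, so the integrand is [F 1] almost everywhere. *)
Lemma F_divergence_self (F : R -> \bar R) nu mu :
  (forall s, (0 <= s)%R -> 0 <= F s) -> measurable_fun setT F -> F 1%R = 0 ->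
  (forall A, measurable A -> nu A = mu A) -> F_divergence F nu mu = 0.
Proof.
move=> F0 mF F1 numu; rewrite /F_divergence.
have dom : nu `<< mu.
  by apply/null_content_dominatesP => A mA; rewrite numu.
rewrite asboolT//.
rewrite (@ge0_integral_comp_ae_eq mu _ (cst 1))//=.
- by rewrite F1 integral_cst// mul0e.
- exact: measurable_Radon_Nikodym_SigmaFinite.
- exact: Radon_Nikodym_SigmaFinite.f_ge0.
- apply: Radon_Nikodym_SigmaFinite_unique => // A mA.
  by rewrite integral_cst// mul1e numu.
Qed.

End radon_nikodym_uniqueness.

(** * Pointwise inequalities for the entropy function *)

Section entropy.
Context (R : realType).
Implicit Types s dl : R.

(** The tangent to [U1] at [1 + dl] is the line [s * ln (1 + dl) - dl]. Bounding the logarithm below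
    by [dl / (1 + dl)] leaves a minorant free of logarithms that vanishes at [1 + dl]. Both steps
    are instances of [ln x <= x - 1]. *)
Lemma U1_tangent s dl : 0 <= s -> -1 < dl ->
  dl * (s - 1 - dl) <= (1 + dl) * U1 s.
Proof.
move=> s0 dl1; have d0 : 0 < 1 + dl by lra.
move: s0; rewrite le_eqVlt => /predU1P[<-|s0].
  by rewrite /U1 mul0r; have := sqr_ge0 (1 + dl); rewrite expr2; lra.
have /le_ln1Dx : -1 < (1 + dl) / s - 1 by rewrite ltrBDl subrr divr_gt0.
rewrite addrCA subrr addr0 ln_div// => h1.
have /le_ln1Dx : -1 < (1 + dl)^-1 - 1 by rewrite ltrBDl subrr invr_gt0.
rewrite addrCA subrr addr0 lnV// => h2.
have {}h1 : s * (ln (1 + dl) - ln s) <= 1 + dl - s.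
  have -> : 1 + dl - s = s * ((1 + dl) / s - 1) by field; rewrite gt_eqF.
  by rewrite ler_pM2l.
have {}h2 : - ((1 + dl) * ln (1 + dl)) <= - dl.
  have -> : - dl = (1 + dl) * ((1 + dl)^-1 - 1) by field; rewrite gt_eqF.
  by rewrite -mulrN ler_pM2l.
have {}h2 := ler_wpM2l (ltW s0) h2.
have {}h1 := ler_wpM2l (ltW d0) h1.
rewrite /U1; nra.
Qed.

Lemma U1_ge0 s : 0 <= s -> 0 <= U1 s.
Proof.
by move=> s0; have := @U1_tangent s 0 s0; rewrite addr0 mul0r mul1r; apply; lra.
Qed.

Lemma measurable_U1 : measurable_fun [set: R] (@U1 R).
Proof.
apply: measurable_funD => //; apply: measurable_funB => //.
by apply: measurable_funM => //; exact: measurable_ln.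
Qed.

(** As max minus min is [|s - 1|], this is a linearised Pinsker inequality with a free threshold
    [dl]. It follows from [U1_tangent] at [dl] and at [- dl], where the factors [1 + dl] and
    [1 - dl] are bounded by 2. *)
Lemma max1_le_U1 s dl : 0 <= s -> 0 < dl < 1 ->
  Num.max 1 s <= Num.min 1 s + dl + 2 / dl * U1 s.
Proof.
move=> s0 /andP[d0 d1].
have U0 := U1_ge0 s0.
have hp : s - 1 <= dl + 2 / dl * U1 s.
  have h : dl * (s - 1 - dl) <= (1 + dl) * U1 s by apply: U1_tangent => //; lra.
  have : s - 1 - dl <= (1 + dl) * U1 s / dl by rewrite ler_pdivlMr// mulrC.
  have : (1 + dl) * U1 s / dl <= 2 / dl * U1 s.
    by rewrite mulrAC ler_wpM2r// ler_wpM2r ?invr_ge0; lra.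
  by lra.
have hn : 1 - s <= dl + 2 / dl * U1 s.
  have h : (- dl) * (s - 1 - (- dl)) <= (1 + - dl) * U1 s.
    by apply: U1_tangent => //; lra.
  have : 1 - s - dl <= (1 - dl) * U1 s / dl by rewrite ler_pdivlMr// mulrC; lra.
  have : (1 - dl) * U1 s / dl <= 2 / dl * U1 s.
    by rewrite mulrAC ler_wpM2r// ler_wpM2r ?invr_ge0; lra.
  by lra.
by rewrite /Num.max /Num.min; case: ifPn; lra.
Qed.

End entropy.

(** * Cutting a density off at height 1, with an error controlled by the entropy *)

Section entropy_truncation.
Context d (T : measurableType d) (R : realType).
Local Open Scope ereal_scope.
Implicit Types mu nu : {finite_measure set T -> \bar R}.

(* a = min(1, 1/f) for f the density of nu, so that a * nu has density min(1, f) *)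
Lemma entropy_truncation nu mu : nu `<< mu ->
  exists a : T -> R, [/\ measurable_fun [set: T] a,
    forall x, (0 <= a x <= 1)%R,
    forall A, measurable A -> \int[nu]_(x in A) (a x)%:E <= mu A &
    forall dl : R, (0 < dl < 1)%R ->
      let err := dl%:E * mu setT
        + (2 / dl)%:E * F_divergence (fun s => (U1 s)%:E) nu mu in
      mu setT <= \int[nu]_x (a x)%:E + err /\
      nu setT <= \int[nu]_x (a x)%:E + err].
Proof.
move=> numu.
pose f := fine \o Radon_Nikodym_SigmaFinite.f nu mu.
have fE x : (f x)%:E = Radon_Nikodym_SigmaFinite.f nu mu x.
  by rewrite fineK// Radon_Nikodym_SigmaFinite.f_fin_num.
have f0 x : (0 <= f x)%R.
  by apply: fine_ge0; exact: Radon_Nikodym_SigmaFinite.f_ge0.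
have mf : measurable_fun [set: T] f.
  by apply: measurableT_comp => //; exact: measurable_Radon_Nikodym_SigmaFinite.
(* The inverse is written as a real power so that its measurability comes from [measurable_powR]. *)
pose a x := (Num.max 1 (f x) `^ (-1))%R.
have max1 x : (1 <= Num.max 1 (f x))%R by rewrite le_max lexx.
have max0 x : (0 < Num.max 1 (f x))%R by rewrite (lt_le_trans _ (max1 x)).
have aE x : a x = ((Num.max 1 (f x))^-1)%R by rewrite /a powR_inv1// ltW.
have a0 x : (0 <= a x)%R by rewrite powR_ge0.
have a1 x : (a x <= 1)%R by rewrite aE invf_le1.
have afE x : (a x * f x = Num.min 1 (f x))%R.
  rewrite aE /Num.max /Num.min; case: ifPn => f1.
    by rewrite mulVf// gt_eqF// (lt_trans _ f1).
  by rewrite invr1 mul1r.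
have ma : measurable_fun [set: T] a.
  apply: (measurableT_comp (measurable_powR _)).
  exact: measurable_maxr.
have intaE A : measurable A ->
    \int[nu]_(x in A) (a x)%:E = \int[mu]_(x in A) (a x * f x)%:E.
  move=> mA; rewrite -(Radon_Nikodym_SigmaFinite.change_of_variables numu)//.
  - by apply: eq_integral => x _; rewrite EFinM fE.
  - exact/measurable_funTS/measurable_EFinP.
have maf : measurable_fun [set: T] (fun x => (a x * f x)%:E).
  by apply/measurable_EFinP; exact: measurable_funM.
exists a; split => //.
- by move=> x; rewrite a0 a1.
- move=> A mA; rewrite intaE// -[leRHS]mul1e -integral_cst//.
  apply: ge0_le_integral => //.
  + by move=> x _; rewrite lee_fin mulr_ge0.
  + exact: measurable_funTS.
  + by move=> x _; rewrite afE lee_fin ge_min lexx.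
- move=> dl d01 err; have [d0 d1] := andP d01.
  have -> : \int[nu]_x (a x)%:E + err =
    \int[mu]_x ((a x * f x)%:E + (dl%:E + ((2 / dl)%:E * (U1 (f x))%:E))).
    have mU : measurable_fun [set: T] (fun x => (U1 (f x))%:E).
      by apply/measurable_EFinP; apply: (measurableT_comp (@measurable_U1 R)).
    have U0 x : 0 <= (U1 (f x))%:E by rewrite lee_fin U1_ge0.
    have dU x : 0 <= (2 / dl)%:E * (U1 (f x))%:E.
      by rewrite mule_ge0// lee_fin divr_ge0// ltW.
    have d0' : 0 <= dl%:E by rewrite lee_fin ltW.
    have mdU : measurable_fun [set: T] (fun x => (2 / dl)%:E * (U1 (f x))%:E).
      exact: emeasurable_funM.
    rewrite ge0_integralD//; last 3 first.
    + by move=> x _; rewrite lee_fin mulr_ge0.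
    + by move=> x _; rewrite adde_ge0.
    + exact: emeasurable_funD.
    rewrite ge0_integralD//.
    rewrite ge0_integralZl//; last by rewrite lee_fin divr_ge0// ltW.
    rewrite -intaE// /err /F_divergence asboolT//.
    by rewrite [X in _ + (X + _)]integral_cst.
  have mI : measurable_fun [set: T]
      (fun x => (a x * f x)%:E + (dl%:E + ((2 / dl)%:E * (U1 (f x))%:E))).
    apply: emeasurable_funD => //; apply: emeasurable_funD => //.
    apply: emeasurable_funM => //.
    by apply/measurable_EFinP; apply: (measurableT_comp (@measurable_U1 R)).
  (* [max 1 f] dominates both 1 and [f], whose integrals against [mu] are the masses of [mu] and of
     [nu]; one pointwise bound thus yields both estimates. *)
  have ub x : (Num.max 1 (f x))%:E <=
      (a x * f x)%:E + (dl%:E + ((2 / dl)%:E * (U1 (f x))%:E)).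
    by rewrite -EFinM -!EFinD lee_fin afE addrA max1_le_U1.
  split.
    rewrite -[leLHS]mul1e -integral_cst//; apply: ge0_le_integral => //.
    by move=> x _; apply: le_trans (ub x); rewrite lee_fin.
  rewrite (Radon_Nikodym_SigmaFinite.f_integral numu)//.
  apply: ge0_le_integral => //.
  + by move=> x _; exact: Radon_Nikodym_SigmaFinite.f_ge0.
  + exact: measurable_Radon_Nikodym_SigmaFinite.
  + by move=> x _; apply: le_trans (ub x); rewrite -fE lee_fin le_max lexx orbT.
Qed.

End entropy_truncation.

(** * Borel measures on Polish metric spaces *)

Section borel.
Context (R : realType).
Implicit Types X : polishMetricType R.
Local Open Scope ereal_scope.

Lemma measurable_fun_generated (T : pointedType) (G : set (set T)) (f : T -> R) :
  (forall r, G (f @^-1` `]r, +oo[)) ->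
  measurable_fun [set: g_sigma_algebraType G] (f : g_sigma_algebraType G -> R).
Proof.
move=> Gf; apply: (measurability _ (RGenOInfty.measurableE R)) => //.
by move=> _ [_ [r ->] <-]; rewrite setTI; apply: sub_sigma_algebra; exact: Gf.
Qed.

Lemma borel_closed X (A : set X) : closed A -> measurable (A : set (borel X)).
Proof.
move=> cA; rewrite -[A]setCK; apply: measurableC; apply: sub_sigma_algebra.
exact: closed_openC.
Qed.

Lemma mdist_continuous X : continuous (fun z : X * X => mdist z.1 z.2).
Proof.
move=> [x y]; apply/cvgrPdist_lt => e e0.
have e2 : (0 < e / 2)%R by rewrite divr_gt0.
exists (ball x (e / 2), ball y (e / 2)); first by split; exact: nbhsx_ballx.
move=> [x' y'] [] /=; rewrite !ballEmdist/= => xx' yy'.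
have h1 := metric_triangle x x' y; have h2 := metric_triangle x' y' y.
have h3 := metric_triangle x' x y'; have h4 := metric_triangle x y y'.
rewrite (metric_sym x' x) in h3; rewrite (metric_sym y' y) in h2.
by rewrite ltr_norml; apply/andP; split; lra.
Qed.

Lemma mdistr_continuous X (a : X) : continuous (fun x : X => mdist x a).
Proof.
move=> x; apply/cvgrPdist_lt => e e0; apply/nbhs_ballP; exists e => //= x'.
rewrite ballEmdist/= => xx'.
have h1 := metric_triangle x x' a; have h2 := metric_triangle x' x a.
rewrite (metric_sym x' x) in h2.
by rewrite ltr_norml; apply/andP; split; lra.
Qed.

Lemma measurable_dist_pow X (p : R) :
  measurable_fun [set: borel (X * X)%type] (fun z => dist_pow p z.1 z.2).
Proof.
apply/measurable_EFinP.
have h : measurable_fun [set: borel (X * X)%type]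
    (fun z : borel (X * X)%type => mdist (z.1 : X) z.2).
  apply: measurable_fun_generated => r.
  by apply: open_comp; [move=> z _; exact: mdist_continuous|exact: rray_open].
exact: (measurableT_comp (measurable_powR p) h).
Qed.

Lemma measurable_dist_powr X (p : R) (a : X) :
  measurable_fun [set: borel X] (fun x : borel X => dist_pow p (x : X) a).
Proof.
apply/measurable_EFinP.
have h : measurable_fun [set: borel X] (fun x : borel X => mdist (x : X) a).
  apply: measurable_fun_generated => r.
  by apply: open_comp; [move=> z _; exact: mdistr_continuous|exact: rray_open].
exact: (measurableT_comp (measurable_powR p) h).
Qed.

Lemma dist_pow_ge0 X (p : R) (x y : X) : 0 <= dist_pow p x y.
Proof. by rewrite lee_fin powR_ge0. Qed.

Lemma dense_sequence X : exists a : nat -> X,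
  forall (z : X) (e : R), (0 < e)%R -> exists n, ball (a n) e z.
Proof.
have [D /countable_injP[f injf] dD] := @separable_subproof R X.
(* Indices outside the image of [D] get the default [point]; density is only tested at indices [f x]
   with [x] in [D]. *)
exists (fun n => xget point [set x | D x /\ f x = n]) => z e e0.
have [x [zx Dx]] : (ball z e)^° `&` D !=set0.
  apply: dD; last exact: open_interior.
  by exists z; apply: nbhs_singleton; apply: nbhs_interior; exact: nbhsx_ballx.
exists (f x); case: xgetP => [y _ [Dy /injf yx]|/(_ x)]; last by case.
by rewrite yx ?inE//; apply: ball_sym; exact: interior_subset zx.
Qed.

Lemma metric_ball_open X (a : X) (r : R) : open (ball a r).
Proof.
rewrite ballEmdist (_ : mkset _ = (fun x : X => mdist x a) @^-1` `]-oo, r[%classic).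
  by apply: open_comp; [move=> x _; exact: mdistr_continuous|exact: lray_open].
by apply/seteqP; split => x /=; rewrite in_itv/= metric_sym.
Qed.

Lemma twice_inv_nat_lt (e : R) : (0 < e)%R ->
  exists n : nat, (n.+1%:R^-1 + n.+1%:R^-1 < e)%R.
Proof.
move=> e0; have [|n ne] := @ltr_add_invr R 0 (e / 2); first by rewrite divr_gt0.
exists n; rewrite add0r in ne; rewrite [ltRHS](splitr e).
by rewrite ltrD.
Qed.

(** By separability an open set is a countable union of products of balls centred on a dense
    sequence. Hence Borel sets of the product lie in the product sigma-algebra, and product measures
    can be read as Borel measures. *)
Lemma open_prod_measurable X (U : set (X * X)) : open U ->
  measurable (U : set (borel X * borel X)).
Proof.
move=> oU; have [a aD] := dense_sequence X.
pose B (q : nat * nat * nat) : set (borel X * borel X) :=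
  ball (a q.1.1) q.2.+1%:R^-1 `*` ball (a q.1.2) q.2.+1%:R^-1.
have -> : (U : set (borel X * borel X)) = \bigcup_(q in [set q | B q `<=` U]) B q.
  apply/seteqP; split=> [[x y] Uxy|z [q qU /qU]//].
  have [[P Q] /= [/nbhs_ballP[e1 /= e10 e1P] /nbhs_ballP[e2 /= e20 e2Q]] PQU] :
    nbhs (x, y) U by exact: open_nbhs_nbhs.
  have [|n ne] := @twice_inv_nat_lt (Num.min e1 e2); first by rewrite lt_min e10.
  have n0 : (0 < n.+1%:R^-1 :> R)%R by rewrite invr_gt0.
  have [k xa] := aD x _ n0; have [l yb] := aD y _ n0.
  have half e (c w w' : X) : (Num.min e1 e2 <= e)%R ->
      ball c n.+1%:R^-1 w -> ball c n.+1%:R^-1 w' -> ball w e w'.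
    move=> le_e /ball_sym cw cw'; apply: (@le_ball _ _ _ (n.+1%:R^-1 + n.+1%:R^-1)).
      by apply: le_trans le_e; exact: ltW.
    exact: ball_triangle cw cw'.
  exists (k, l, n) => //= -[x' y'] [/= xx' yy']; apply: PQU.
  split => /=.
  - by apply: e1P; apply: half xa xx'; rewrite ge_min lexx.
  - by apply: e2Q; apply: half yb yy'; rewrite ge_min lexx orbT.
rewrite bigcup_mkcond; apply: countable_bigcupT_measurable => // q.
case: ifPn => // _; apply: measurableX; apply: sub_sigma_algebra;
  exact: metric_ball_open.
Qed.

(** The witness is the product measure divided by the common mass [r]. When [r = 0] both measures
    vanish, and the convention that the inverse of 0 is 0 keeps the formula valid. *)
Lemma coupling_exists X (rho1 rho2 : {finite_measure set borel X -> \bar R}) :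
  rho1 setT = rho2 setT -> coupling rho1 rho2 !=set0.
Proof.
move=> rhoT.
pose r := fine (rho1 setT).
have rE : rho1 setT = r%:E by rewrite fineK// fin_num_measure.
have r0 : (0 <= r)%R by apply: fine_ge0.
have rV0 : (0 <= r^-1)%R by rewrite invr_ge0.
(* The identity only changes the sigma-algebra, from the product one to the Borel one; pushing
   forward along it restricts the product measure to Borel sets. *)
pose idX := id : borel X * borel X -> borel (X * X)%type.
have midX : measurable_fun setT idX.
  move=> _; apply: smallest_sub; last first.
    by move=> U oU; rewrite setTI; exact: open_prod_measurable.
  split => [|A mA|F mF].
  - by rewrite preimage_set0 setI0.
  - rewrite setTD preimage_setC setTI; apply: measurableC.
    by rewrite -[X in measurable X]setTI.
  - rewrite preimage_bigcup setTI; apply: bigcupT_measurable => i.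
    by have := mF i; rewrite setTI.
have @P : {measure set borel (X * X)%type -> \bar R}.
  by refine (pushforward (rho1 \x rho2) idX); exact: midX.
have PE A : P A = (rho1 \x rho2) A by [].
pose M : {measure set borel (X * X)%type -> \bar R} :=
  mscale (NngNum rV0) P.
have ME (A1 A2 : set (borel X)) : measurable A1 -> measurable A2 ->
    M (A1 `*` A2 : set (X * X)) = r^-1%:E * (rho1 A1 * rho2 A2).
  by move=> mA1 mA2; rewrite /M/= /mscale/= PE product_measure1E.
have [g gE] : exists g : {finite_measure set borel (X * X)%type -> \bar R},
    forall A, g A = M A.
  apply: finite_measure_of_fun => //.
  - exact: measure_semi_sigma_additive.
  - move=> A mA; rewrite ge0_fin_numE//.
    apply: (@le_lt_trans _ _ (M (setT `*` setT))).
      by apply: le_measure; rewrite ?inE// setXTT.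
    by rewrite ME// -rhoT rE -!EFinM ltry.
exists g => A mA.
have zero (rho : {finite_measure set borel X -> \bar R}) : r = 0%R ->
    rho setT = rho1 setT -> rho A = 0.
  move=> re0 rhoTr; apply/eqP; rewrite eq_le measure_ge0 andbT.
  by rewrite -[0]/(0%:E) -re0 -rE -rhoTr le_measure ?inE.
have unit (x : \bar R) : r != 0%R -> r^-1%:E * (x * r%:E) = x.
  by move=> rn0; rewrite muleCA -EFinM mulVf// mule1.
split.
- transitivity (M (A `*` setT : set (X * X))).
    rewrite -gE /marg1/= /pushforward; congr (g _).
    by apply/seteqP; split => z //= [].
  rewrite ME// -rhoT rE; have [re0|rn0] := eqVneq r 0%R; last exact: unit.
  by rewrite (zero rho1)// mul0e mule0.
- transitivity (M (setT `*` A : set (X * X))).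
    rewrite -gE /marg2/= /pushforward; congr (g _).
    by apply/seteqP; split => z //= [].
  rewrite ME// rE; have [re0|rn0] := eqVneq r 0%R; last by rewrite (muleC r%:E) unit.
  by rewrite (zero rho2)// !mule0.
Qed.

(** A point off the support has a null neighbourhood, hence lies in a null ball with centre in a
    dense sequence and radius an inverse integer. There are only countably many such balls. *)
Lemma supp_full X (mu : {finite_measure set borel X -> \bar R}) :
  mu (~` supp mu) = 0.
Proof.
have [a aD] := dense_sequence X.
pose B k n : set (borel X) := ball (a k) n.+1%:R^-1.
have mB k n : measurable (B k n).
  by apply: sub_sigma_algebra; exact: metric_ball_open.
pose N k n : set (borel X) := if mu (B k n) == 0 then B k n else set0.
have sN : ~` supp mu `<=` \bigcup_k \bigcup_n N k n.
  move=> x; rewrite /supp/= => /existsNP[U /not_implyP[oU /not_implyP[Ux]]].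
  move=> /negP; rewrite -leNgt => muU.
  have /nbhs_ballP[e /= e0 eU] : nbhs x U by exact: open_nbhs_nbhs.
  have [n ne] := twice_inv_nat_lt e0.
  have n0 : (0 < n.+1%:R^-1 :> R)%R by rewrite invr_gt0.
  have [k xk] := aD x _ n0.
  exists k => //; exists n => //; rewrite /N ifT//.
  rewrite eq_le measure_ge0 andbT; apply: le_trans muU; apply: le_measure.
  - by rewrite inE.
  - by rewrite inE; exact: sub_sigma_algebra.
  - move=> y ky; apply: eU.
    apply: (@le_ball _ _ _ (n.+1%:R^-1 + n.+1%:R^-1)); first exact: ltW.
    exact: ball_triangle (ball_sym xk) ky.
apply/negligibleP.
  by apply: measurableC; apply: borel_closed; exact: supp_closed.
apply: (@negligibleS _ _ _ mu (\bigcup_k \bigcup_n N k n)) => //.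
apply: negligible_bigcup => k.
apply: negligible_bigcup => n; rewrite /N; case: ifPn => [/eqP muB|_].
  exact/negligibleP.
exact: negligible_set0.
Qed.

Lemma measureI_supp X (mu : {finite_measure set borel X -> \bar R})
    (A : set (borel X)) : measurable A -> mu (A `&` supp mu) = mu A.
Proof.
move=> mA; have mS : measurable (supp mu : set (borel X)).
  by apply: borel_closed; exact: supp_closed.
rewrite -[in RHS](setUIDK A (supp mu)) measureU//; last 3 first.
- exact: measurableI.
- exact: measurableD.
- by apply/seteqP; split => // x [[_ ?] [_ ?]].
rewrite [X in _ + X](_ : _ = 0) ?adde0//.
apply/eqP; rewrite eq_le measure_ge0 andbT -(supp_full mu).
by apply: le_measure => [||x []//]; rewrite inE;
  [exact: measurableD|exact: measurableC].
Qed.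

End borel.

(** * Integration against the push-forward of a measure from its support *)

Section support_pushforward_integral.
Context (R : realType) (X Y : polishMetricType R).
Context (mu : {finite_measure set borel X -> \bar R}).
Context (psi : isometric_embedding Y (supp mu)).
Local Open Scope ereal_scope.

(** Extending [psi] by a constant off the support, a null set, turns [supp_pushforward] into an
    ordinary push-forward along a map defined on all of [X]. *)
Let phi (x : borel X) : borel Y :=
  if pselect (supp mu x) is left h then psi (SigSub (mem_set h)) else point.

Let phiE (x : supp mu) : phi (set_val x) = psi x.
Proof.
rewrite /phi; case: pselect => [h|]; last by case; exact: set_valP.
by congr (psi _); apply: val_inj.
Qed.

Let mphi : measurable_fun [set: borel X] phi.
Proof.
move=> _ B mB; rewrite setTI.
have mS : measurable (supp mu : set (borel X)).
  by apply: borel_closed; exact: supp_closed.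
have -> : phi @^-1` B = set_val @` (psi @^-1` B) `|`
    (~` supp mu `&` [set _ | B point]).
  apply/seteqP; split=> [x|x [[y By <-]|[nSx Bp]]].
  - rewrite /phi/=; case: pselect => [h Bx|h Bp]; [left|by right].
    by exists (SigSub (mem_set h)).
  - by rewrite /preimage/= phiE.
  - by rewrite /preimage/= /phi; case: pselect.
apply: measurableU.
  by apply: measurable_embedding => //; exact: supp_closed.
apply: measurableI; first exact: measurableC.
have [Bp|nBp] := pselect (B point).
- by rewrite (_ : [set _ | _] = setT)//; apply/seteqP; split.
- by rewrite (_ : [set _ | _] = set0)//; apply/seteqP; split.
Qed.

Let supp_pushforwardE (B : set (borel Y)) : measurable B ->
  supp_pushforward psi B = mu (phi @^-1` B).
Proof.
move=> mB; have mpre : measurable (phi @^-1` B).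
  by rewrite -[X in measurable X]setTI; exact: mphi.
rewrite -(measureI_supp mu mpre); congr (mu _).
apply/seteqP; split => [_ [y By <-]|x [Bx Sx]].
  by split; [rewrite /preimage/= phiE|exact: set_valP].
by exists (SigSub (mem_set Sx)) => //; rewrite /preimage/= -phiE.
Qed.

Lemma supp_pushforwardT : supp_pushforward psi setT = mu setT.
Proof. by rewrite supp_pushforwardE. Qed.

(** This change of variables makes moments independent of the embedding. Comparing [f] and [f'] on
    the support is enough since its complement is null. *)
Lemma integral_supp_pushforward (f : borel Y -> \bar R) (f' : borel X -> \bar R) :
  measurable_fun setT f -> (forall y, 0 <= f y) ->
  measurable_fun setT f' -> (forall x, 0 <= f' x) ->
  (forall x : supp mu, f (psi x) = f' (set_val x)) ->
  \int[supp_pushforward psi]_y f y = \int[mu]_x f' x.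
Proof.
move=> mf f0 mf' f'0 ff'.
have @P : {measure set borel Y -> \bar R}.
  by refine (pushforward mu phi); exact: mphi.
transitivity (\int[P]_y f y).
  by apply: eq_measure_integral => A mA _; exact: supp_pushforwardE.
rewrite ge0_integral_pushforward// preimage_setT.
apply: ge0_ae_eq_integral => //.
- exact: measurableT_comp.
- by move=> x _; exact: f0.
exists (~` supp mu); split.
- by apply: measurableC; apply: borel_closed; exact: supp_closed.
- exact: supp_full.
- move=> x /= + Sx; apply => _.
  by rewrite -[x]/(set_val (SigSub (mem_set Sx))) phiE ff'.
Qed.

End support_pushforward_integral.

(** * Marginals of plans, and truncation of a plan to fit under prescribed marginals *)

Section marginals.
Context (R : realType) (X : polishMetricType R).
Local Open Scope ereal_scope.
Implicit Types g s : {finite_measure set borel (X * X)%type -> \bar R}.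
Implicit Types mu rho : {finite_measure set borel X -> \bar R}.

Lemma ge0_integral_marg1 g (D : set (borel X)) (f : borel X -> \bar R) :
  measurable D -> measurable_fun setT f -> (forall x, 0 <= f x) ->
  \int[marg1 g]_(x in D) f x = \int[g]_(z in fst @^-1` D) f z.1.
Proof.
move=> mD mf f0.
have @P : {measure set borel X -> \bar R}.
  refine (pushforward g (fst : borel (X * X)%type -> borel X)).
  exact: measurable_fst_borel.
transitivity (\int[P]_(x in D) f x); first exact: eq_measure_integral.
rewrite ge0_integral_pushforward//; last exact: measurable_funTS.
exact: measurable_fst_borel.
Qed.

Lemma ge0_integral_marg2 g (D : set (borel X)) (f : borel X -> \bar R) :
  measurable D -> measurable_fun setT f -> (forall x, 0 <= f x) ->
  \int[marg2 g]_(x in D) f x = \int[g]_(z in snd @^-1` D) f z.2.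
Proof.
move=> mD mf f0.
have @P : {measure set borel X -> \bar R}.
  refine (pushforward g (snd : borel (X * X)%type -> borel X)).
  exact: measurable_snd_borel.
transitivity (\int[P]_(x in D) f x); first exact: eq_measure_integral.
rewrite ge0_integral_pushforward//; last exact: measurable_funTS.
exact: measurable_snd_borel.
Qed.

Lemma marg1T g : marg1 g setT = g setT.
Proof. by rewrite /marg1 /pushforward preimage_setT. Qed.

Lemma marg2T g : marg2 g setT = g setT.
Proof. by rewrite /marg2 /pushforward preimage_setT. Qed.

Lemma F_divergence_U1_ge0 rho mu : 0 <= F_divergence (fun t : R => (U1 t)%:E) rho mu.
Proof.
rewrite /F_divergence; case: asboolP => // dom; apply: integral_ge0 => x _.
by rewrite lee_fin U1_ge0// fine_ge0// Radon_Nikodym_SigmaFinite.f_ge0.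
Qed.

(** The weight [a1 x * a2 y] is below each of its factors, so each marginal of [gt] inherits the
    bound of the corresponding truncation. The two deficits have equal mass, because [mu1] and [mu2]
    do and both marginals of [gt] carry the mass of [gt]; hence they can be coupled by [s]. *)
Lemma coupling_truncation g mu1 mu2 :
  marg1 g `<< mu1 -> marg2 g `<< mu2 -> mu1 setT = mu2 setT ->
  let U (t : R) := (U1 t)%:E in
  exists gt s : {finite_measure set borel (X * X)%type -> \bar R}, [/\
    forall A, measurable A -> gt A <= g A,
    forall A, measurable A -> marg1 gt A + marg1 s A = mu1 A,
    forall A, measurable A -> marg2 gt A + marg2 s A = mu2 A &
    forall dl : R, (0 < dl < 1)%R ->
      s setT <= dl%:E * (mu1 setT + mu2 setT) + (2 / dl)%:E *
        (F_divergence U (marg1 g) mu1 + F_divergence U (marg2 g) mu2)].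
Proof.
move=> dom1 dom2 mu12 U.
have [a1 [ma1 a101 a1le a1err]] := entropy_truncation dom1.
have [a2 [ma2 a201 a2le a2err]] := entropy_truncation dom2.
pose h (z : borel (X * X)%type) := (a1 z.1 * a2 z.2)%R.
have ma1' : measurable_fun [set: borel (X * X)%type] (a1 \o fst).
  by apply: measurableT_comp ma1 _; exact: measurable_fst_borel.
have ma2' : measurable_fun [set: borel (X * X)%type] (a2 \o snd).
  by apply: measurableT_comp ma2 _; exact: measurable_snd_borel.
have mh : measurable_fun [set: borel (X * X)%type] h by exact: measurable_funM.
have h1 z : (0 <= h z <= a1 z.1)%R.
  have [/andP[a10 a11] /andP[a20 a21]] := (a101 z.1, a201 z.2).
  by rewrite /h mulr_ge0//= ler_piMr.
have h2 z : (h z <= a2 z.2)%R.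
  have [/andP[a10 a11] /andP[a20 a21]] := (a101 z.1, a201 z.2).
  by rewrite /h ler_piMl.
have h01 z : (0 <= h z <= 1)%R.
  by have /andP[-> /le_trans ->//] := h1 z; case/andP: (a101 z.1).
have [gt gtE] := finite_measure_of_density g mh h01.
have mpre1 (A : set (borel X)) : measurable A ->
    measurable (fst @^-1` A : set (borel (X * X)%type)).
  by move=> mA; rewrite -[X in measurable X]setTI; exact: measurable_fst_borel.
have mpre2 (A : set (borel X)) : measurable A ->
    measurable (snd @^-1` A : set (borel (X * X)%type)).
  by move=> mA; rewrite -[X in measurable X]setTI; exact: measurable_snd_borel.
have gt1 A : measurable A -> marg1 gt A <= mu1 A.
  move=> mA; apply: le_trans (a1le A mA).
  rewrite ge0_integral_marg1//; last 2 first.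
  - exact/measurable_EFinP.
  - by move=> x; rewrite lee_fin; case/andP: (a101 x).
  rewrite /marg1 /pushforward gtE; apply: ge0_le_integral => //.
  - exact: mpre1.
  - by move=> z _; rewrite lee_fin; case/andP: (h1 z).
  - exact/measurable_funTS/measurable_EFinP.
  - exact/measurable_funTS/measurable_EFinP.
  - by move=> z _; rewrite lee_fin; case/andP: (h1 z).
have gt2 A : measurable A -> marg2 gt A <= mu2 A.
  move=> mA; apply: le_trans (a2le A mA).
  rewrite ge0_integral_marg2//; last 2 first.
  - exact/measurable_EFinP.
  - by move=> x; rewrite lee_fin; case/andP: (a201 x).
  rewrite /marg2 /pushforward gtE; apply: ge0_le_integral => //.
  - exact: mpre2.
  - by move=> z _; rewrite lee_fin; case/andP: (h1 z).
  - exact/measurable_funTS/measurable_EFinP.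
  - exact/measurable_funTS/measurable_EFinP.
  - by move=> z _; rewrite lee_fin.
have [rho1 rho1E] : exists rho : {finite_measure set borel X -> \bar R},
    forall A, measurable A -> marg1 gt A + rho A = mu1 A by exact: measure_complement.
have [rho2 rho2E] : exists rho : {finite_measure set borel X -> \bar R},
    forall A, measurable A -> marg2 gt A + rho A = mu2 A by exact: measure_complement.
have fin (m : {finite_measure set borel (X * X)%type -> \bar R}) :
  m setT \is a fin_num by exact: fin_num_measure.
have rhoT : rho1 setT = rho2 setT.
  have := rho1E _ measurableT; rewrite mu12 -(rho2E _ measurableT).
  rewrite marg1T marg2T => /eqP.
  by rewrite eq_le !leeD2lE// -eq_le => /eqP.
have [s sE] := coupling_exists rhoT.
exists gt, s; split.
- move=> A mA; rewrite gtE -[leRHS]mul1e -integral_cst//.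
  apply: ge0_le_integral => //.
  + by move=> z _; rewrite lee_fin; case/andP: (h01 z).
  + exact/measurable_funTS/measurable_EFinP.
  + by move=> z _; rewrite lee_fin; case/andP: (h01 z).
- by move=> A mA; rewrite -rho1E// (sE A mA).1.
- by move=> A mA; rewrite -rho2E// (sE A mA).2.
move=> dl dl01.
have pa1 (z : borel (X * X)%type) : 0 <= (a1 z.1)%:E.
  by rewrite lee_fin; case/andP: (a101 z.1).
have pa2 (z : borel (X * X)%type) : 0 <= (a2 z.2)%:E.
  by rewrite lee_fin; case/andP: (a201 z.2).
have ph z : 0 <= (h z)%:E by rewrite lee_fin; case/andP: (h01 z).
move/measurable_EFinP : ma1' => ma1'; move/measurable_EFinP : ma2' => ma2'.
move/measurable_EFinP : mh => mh.
have mu1E : mu1 setT = gt setT + s setT.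
  by rewrite -(rho1E _ measurableT) marg1T -(sE _ measurableT).1 marg1T.
pose I1 := \int[g]_z (a1 z.1)%:E; pose I2 := \int[g]_z (a2 z.2)%:E.
have I1E : \int[marg1 g]_x (a1 x)%:E = I1.
  rewrite ge0_integral_marg1//; last by move=> x; rewrite lee_fin; case/andP: (a101 x).
  exact/measurable_EFinP.
have I2E : \int[marg2 g]_x (a2 x)%:E = I2.
  rewrite ge0_integral_marg2//; last by move=> x; rewrite lee_fin; case/andP: (a201 x).
  exact/measurable_EFinP.
pose E1 := F_divergence U (marg1 g) mu1; pose E2 := F_divergence U (marg2 g) mu2.
have E10 : 0 <= E1 by exact: F_divergence_U1_ge0.
have E20 : 0 <= E2 by exact: F_divergence_U1_ge0.
(* The truncation bounds are used asymmetrically, for the mass of [mu1] on the first side and for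
   the mass of [g] on the second, so that [g setT] cancels against the one in [sum]. *)
have err1 : mu1 setT <= I1 + (dl%:E * mu1 setT + (2 / dl)%:E * E1).
  by rewrite -I1E; exact: (a1err dl dl01).1.
have err2 : g setT <= I2 + (dl%:E * mu2 setT + (2 / dl)%:E * E2).
  by rewrite -I2E -marg2T; exact: (a2err dl dl01).2.
(* Integrates [a1 + a2 <= 1 + a1 * a2], which says that the product of [1 - a1] and [1 - a2] is
   nonnegative. *)
have sum : I1 + I2 <= g setT + gt setT.
  rewrite gtE -[g setT]mul1e -integral_cst// -!ge0_integralD//.
  apply: ge0_le_integral => //.
  - by move=> z _; exact: adde_ge0.
  - exact: emeasurable_funD.
  - exact: emeasurable_funD.
  - move=> z _; rewrite -!EFinD lee_fin /h.
    have [/andP[a10 a11] /andP[a20 a21]] := (a101 z.1, a201 z.2).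
    by nra.
rewrite ge0_muleDr// [X in _ + X]ge0_muleDr// addeACA.
(* Adding this finite quantity to both sides replaces a subtraction in the extended reals. *)
have F : g setT + gt setT \is a fin_num by rewrite fin_numD !fin.
rewrite -(leeD2lE _ _ F).
apply: (le_trans _ (leeD sum (lexx _))); rewrite [leRHS]addeACA.
have -> : g setT + gt setT + s setT = mu1 setT + g setT.
  by rewrite mu1E -addeA [RHS]addeC.
exact: leeD err1 err2.
Qed.

End marginals.

(** * Transport costs *)

Section cost_estimates.
Context (R : realType).
Implicit Types X : polishMetricType R.
Local Open Scope ereal_scope.

(** The sum is at most three times its largest term [m], and the power of [m] is one of the three on
    the right. *)
Lemma powR_add3_le (p u v w : R) : (0 < p -> 0 <= u -> 0 <= v -> 0 <= w ->
  (u + v + w) `^ p <= 3 `^ p * (u `^ p + v `^ p + w `^ p))%R.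
Proof.
move=> p0 u0 v0 w0; pose m := Num.max u (Num.max v w).
have [um vm wm] : [/\ (u <= m)%R, (v <= m)%R & (w <= m)%R].
  by rewrite /m !le_max !lexx !orbT.
have m0 : (0 <= m)%R by exact: le_trans um.
apply: (@le_trans _ _ ((3 * m) `^ p)%R).
  by apply: ge0_ler_powR; rewrite ?nnegrE; lra.
rewrite powRM// ler_wpM2l ?powR_ge0//.
have pu := powR_ge0 u p; have pv := powR_ge0 v p; have pw := powR_ge0 w p.
by rewrite /m; case: (leP v w) => _; case: (leP u _) => _; lra.
Qed.

Lemma dist_powC X (p : R) (x y : X) : dist_pow p x y = dist_pow p y x.
Proof. by rewrite /dist_pow metric_sym. Qed.

Lemma dist_pow_quadrangle X (p : R) (x y a b : X) : (0 < p)%R ->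
  dist_pow p x y <=
  (3 `^ p)%:E * (dist_pow p x a + dist_pow p a b + dist_pow p y b).
Proof.
move=> p0; rewrite (dist_powC p y b) /dist_pow -!EFinD -EFinM lee_fin.
apply: le_trans (powR_add3_le p0 _ _ _); [|exact: mdist_ge0..].
apply: ge0_ler_powR; rewrite ?nnegrE ?addr_ge0 ?mdist_ge0//; first exact: ltW.
apply: le_trans (metric_triangle x b y) _; rewrite lerD2r.
exact: metric_triangle.
Qed.

(** The excesses of [h] over the integers [n] tend to 0 and are dominated by the integrable [h], so
    dominated convergence applies. *)
Lemma integral_tail d (T : measurableType d)
    (mu : {measure set T -> \bar R}) (h : T -> R) (e : R) :
  measurable_fun setT h -> (forall x, (0 <= h x)%R) ->
  \int[mu]_x (h x)%:E < +oo -> (0 < e)%R ->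
  exists2 K : R, (0 <= K)%R & \int[mu]_x (Num.max (h x - K) 0)%:E <= e%:E.
Proof.
move=> mh h0 hoo e0.
pose f n x := (Num.max (h x - n%:R) 0)%:E.
have f0 n x : 0 <= f n x by rewrite lee_fin le_max lexx orbT.
have fh n x : f n x <= (h x)%:E.
  by rewrite lee_fin ge_max h0 andbT gerBl.
have [_ _ /= cvg0] : [/\ mu.-integrable setT (cst 0 : T -> \bar R),
    [sequence \int[mu]_x `|f n x - 0|]_n @ \oo --> 0 &
    [sequence \int[mu]_x f n x]_n @ \oo --> \int[mu]_x (cst 0 x)].
  apply: (@dominated_convergence _ _ _ mu setT measurableT f (cst 0)
    (fun x => (h x)%:E)) => //.
  - move=> n; apply/measurable_EFinP; apply: measurable_maxr => //.
    exact: measurable_funB.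
  - apply: aeW => x _; apply: cvg_near_cst.
    exists (Num.bound (h x)) => // n /= hn; rewrite /f.
    rewrite (_ : Num.max _ _ = 0%R)//; apply/max_idPr; rewrite subr_le0 ltW//.
    apply: lt_le_trans (archi_boundP (h0 x)) _.
    by rewrite ler_nat.
  - apply/integrableP; split; first exact/measurable_EFinP.
    by under eq_integral do rewrite gee0_abs ?lee_fin//.
  - by apply: aeW => x n _; rewrite gee0_abs.
rewrite integral0 in cvg0.
have /fine_cvgP[_ /cvgrPdist_lt /(_ _ e0)[N _ /(_ N (leqnn N))]] := cvg0.
rewrite /= sub0r normrN => hN.
exists N%:R => //.
have fin : \int[mu]_x f N x \is a fin_num.
  rewrite ge0_fin_numE; last by apply: integral_ge0 => x _; exact: f0.
  apply: le_lt_trans hoo; apply: ge0_le_integral => //.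
  - apply/measurable_EFinP; apply: measurable_maxr => //.
    exact: measurable_funB.
  - exact/measurable_EFinP.
rewrite -[leLHS](fineK fin) lee_fin.
exact: le_trans (ler_norm _) (ltW hN).
Qed.

(** Cutting [h] at height [K], the bounded part sees only the mass of [rho], and the excess is
    charged to the larger measure [mu]. A small piece of a fixed measure therefore has a small
    integral. *)
Lemma ge0_integral_dominated_split d (T : measurableType d)
    (rho mu : {measure set T -> \bar R}) (h : T -> R) (K : R) :
  (forall A, measurable A -> rho A <= mu A) ->
  measurable_fun setT h -> (forall x, (0 <= h x)%R) -> (0 <= K)%R ->
  \int[rho]_x (h x)%:E <=
  K%:E * rho setT + \int[mu]_x (Num.max (h x - K) 0)%:E.
Proof.
move=> rhomu mh h0 K0.
pose t x := (Num.max (h x - K) 0)%:E.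
have t0 x : 0 <= t x by rewrite lee_fin le_max lexx orbT.
have mt : measurable_fun setT t.
  apply/measurable_EFinP; apply: measurable_maxr => //.
  exact: measurable_funB.
apply: (@le_trans _ _ (\int[rho]_x (cst K%:E x + t x))).
  apply: ge0_le_integral => //.
  - by move=> x _; rewrite lee_fin.
  - exact/measurable_EFinP.
  - exact: emeasurable_funD.
  - move=> x _; rewrite -EFinD lee_fin -lerBlDl le_max lexx//.
rewrite ge0_integralD// integral_cst// leeD2l//.
exact: ge0_le_measure_integral.
Qed.

(** The functions [u] and [v] are kept abstract because the lemma serves twice with exchanged roles:
    once with [u] the cost and [v] the constant d(a,b)^p, once the other way round. *)
Lemma integral_dist_pow_quadrangle X (p : R) (a b : X)
    (s : {finite_measure set borel (X * X)%type -> \bar R})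
    (u v : borel (X * X)%type -> \bar R) :
  measurable_fun setT u -> (forall z, 0 <= u z) ->
  measurable_fun setT v -> (forall z, 0 <= v z) ->
  (forall z, u z <= (3 `^ p)%:E *
    (dist_pow p z.1 a + v z + dist_pow p z.2 b)) ->
  \int[s]_z u z <= (3 `^ p)%:E * (\int[marg1 s]_x dist_pow p (x : X) a
    + \int[s]_z v z + \int[marg2 s]_y dist_pow p (y : X) b).
Proof.
move=> mu u0 mv v0 uv.
rewrite ge0_integral_marg1//; last 2 first.
- exact: measurable_dist_powr.
- by move=> x; exact: dist_pow_ge0.
rewrite ge0_integral_marg2//; last 2 first.
- exact: measurable_dist_powr.
- by move=> x; exact: dist_pow_ge0.
rewrite !preimage_setT.
have m1 : measurable_fun [set: borel (X * X)%type] (fun z => dist_pow p z.1 a).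
  apply: measurableT_comp (measurable_dist_powr p a) _.
  exact: measurable_fst_borel.
have m2 : measurable_fun [set: borel (X * X)%type] (fun z => dist_pow p z.2 b).
  apply: measurableT_comp (measurable_dist_powr p b) _.
  exact: measurable_snd_borel.
have m12 : measurable_fun [set: borel (X * X)%type]
  (fun z => dist_pow p z.1 a + v z) by exact: emeasurable_funD.
pose f1 (z : borel (X * X)%type) := dist_pow p z.1 a.
pose f2 (z : borel (X * X)%type) := dist_pow p z.2 b.
have f10 z : setT z -> 0 <= f1 z by move=> _; exact: dist_pow_ge0.
have f20 z : setT z -> 0 <= f2 z by move=> _; exact: dist_pow_ge0.
have f1v0 z : setT z -> 0 <= f1 z + v z.
  by move=> _; apply: adde_ge0; [exact: f10|exact: v0].
rewrite -(ge0_integralD _ _ f10)// -(ge0_integralD _ _ f1v0)//.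
rewrite -ge0_integralZl_EFin ?powR_ge0//; last 2 first.
- by move=> z _; apply: adde_ge0; [exact: f1v0|exact: f20].
- exact: emeasurable_funD.
apply: ge0_le_integral => //.
by apply: measurable_funeM; exact: emeasurable_funD.
Qed.

Lemma measure_add_finite d (T : measurableType d)
    (m1 m2 : {finite_measure set T -> \bar R}) :
  exists m : {finite_measure set T -> \bar R}, forall A, m A = m1 A + m2 A.
Proof.
have [m mE] : exists m : {finite_measure set T -> \bar R},
    forall A, m A = measure_add m1 m2 A.
  apply: finite_measure_of_fun => //.
  - exact: measure_semi_sigma_additive.
  - by move=> A mA; rewrite measure_addE fin_numD !fin_num_measure.
by exists m => A; rewrite mE measure_addE.
Qed.

End cost_estimates.

(** * Turning a plan of small entropy into a genuine coupling *)

Section coupling_repair.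
Context (R : realType) (X : polishMetricType R).
Local Open Scope ereal_scope.

(** In the final bound [C] pays for the truncated plan and the rest for the coupling [s] of the
    missing marginals, of mass at most [tau]: each marginal of [s] contributes [K * tau + eps], and
    the last summand is [tau] times a bound on d(a,b)^p. *)
Lemma coupling_repair (p : R) (a b : X) (m C K eps tau dl e : R)
    (g : {finite_measure set borel (X * X)%type -> \bar R})
    (mu1 mu2 : {finite_measure set borel X -> \bar R}) :
  (0 < p)%R -> (0 <= K)%R -> (0 < dl < 1)%R ->
  (2 * dl + 2 / dl * e <= tau)%R -> (tau <= 1 / 2)%R ->
  mu1 setT = 1 -> mu2 setT = 1 -> marg1 g `<< mu1 -> marg2 g `<< mu2 ->
  F_divergence (fun t : R => (U1 t)%:E) (marg1 g) mu1
    + F_divergence (fun t : R => (U1 t)%:E) (marg2 g) mu2 <= e%:E ->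
  \int[mu1]_x dist_pow p (x : X) a + \int[mu2]_x dist_pow p (x : X) b <= m%:E ->
  \int[mu1]_x (Num.max (mdist (x : X) a `^ p - K) 0)%:E <= eps%:E ->
  \int[mu2]_x (Num.max (mdist (x : X) b `^ p - K) 0)%:E <= eps%:E ->
  \int[g]_z dist_pow p z.1 z.2 <= C%:E ->
  exists2 g', coupling mu1 mu2 g' & \int[g']_z dist_pow p z.1 z.2 <=
    (C + 3 `^ p * (2 * K * tau + 2 * eps
      + 2 * 3 `^ p * (m + C) * tau))%:E.
Proof.
move=> p0 K0 dl01 dltau tau2 mu1T mu2T dom1 dom2 entr moment tail1 tail2 gC.
have mu12 : mu1 setT = mu2 setT by rewrite mu1T mu2T.
have [gt [s [gtg sum1 sum2 /(_ dl dl01) sT]]] := coupling_truncation dom1 dom2 mu12.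
have [g' g'E] := measure_add_finite gt s.
have [/andP[d0 d1]] := dl01.
have c0 : (0 < 3 `^ p)%R by rewrite powR_gt0.
have p3 : (0 <= 3 `^ p)%R by exact: ltW.
pose sg := fine (s setT).
have sE : s setT = sg%:E by rewrite fineK// fin_num_measure.
have sg0 : (0 <= sg)%R by exact: fine_ge0.
have sgtau : (sg <= tau)%R.
  rewrite -lee_fin -sE; apply: le_trans sT _.
  rewrite mu1T mu2T -[1 + 1]/((1 + 1)%R%:E) -EFinM.
  apply: (@le_trans _ _ ((dl * (1 + 1))%:E + (2 / dl)%:E * e%:E)).
    by rewrite leeD2l// lee_wpmul2l// lee_fin divr_ge0// ltW.
  by rewrite -EFinM -EFinD lee_fin; apply: le_trans dltau; rewrite mulrC.
have gtE : gt setT = (1 - sg)%:E.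
  have := sum1 _ measurableT; rewrite marg1T marg1T mu1T sE => h.
  by rewrite EFinB -h addeK.
have le1 A : measurable A -> marg1 gt A <= mu1 A.
  by move=> mA; rewrite -sum1// leeDl.
have le2 A : measurable A -> marg2 gt A <= mu2 A.
  by move=> mA; rewrite -sum2// leeDl.
have sle1 A : measurable A -> marg1 s A <= mu1 A.
  by move=> mA; rewrite -sum1// leeDr.
have sle2 A : measurable A -> marg2 s A <= mu2 A.
  by move=> mA; rewrite -sum2// leeDr.
have gtC : \int[gt]_z dist_pow p z.1 z.2 <= C%:E.
  apply: le_trans gC; apply: ge0_le_measure_integral => //.
  - by move=> z; exact: dist_pow_ge0.
  - exact: measurable_dist_pow.
pose D := (mdist a b `^ p)%R.
have D0 : (0 <= D)%R by exact: powR_ge0.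
have cD0 (z : borel (X * X)%type) : 0 <= cst (dist_pow p a b) z.
  exact: dist_pow_ge0.
have dp0 (z : borel (X * X)%type) : 0 <= dist_pow p z.1 z.2.
  exact: dist_pow_ge0.
have mdp := @measurable_dist_pow R X p.
have quad1 (z : borel (X * X)%type) : dist_pow p z.1 z.2 <= (3 `^ p)%:E *
    (dist_pow p z.1 a + cst (dist_pow p a b) z + dist_pow p z.2 b).
  exact: dist_pow_quadrangle.
have quad2 (z : borel (X * X)%type) : cst (dist_pow p a b) z <= (3 `^ p)%:E *
    (dist_pow p z.1 a + dist_pow p z.1 z.2 + dist_pow p z.2 b).
  rewrite [dist_pow p z.1 a]dist_powC [dist_pow p z.2 b]dist_powC.
  exact: dist_pow_quadrangle.
(* The leading 2 arises because [gt] has mass [1 - sg], at least 1/2 by [tau <= 1 / 2]. *)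
have DQ : (D <= 2 * 3 `^ p * (m + C))%R.
  have h : dist_pow p a b * gt setT <= (3 `^ p)%:E * (m + C)%:E.
    rewrite -integral_cst//.
    apply: le_trans (integral_dist_pow_quadrangle gt _ cD0 mdp dp0 quad2) _.
      exact: measurable_cst.
    apply: lee_wpmul2l; first by rewrite lee_fin.
    rewrite EFinD addeAC leeD//; apply: le_trans moment; apply: leeD.
    - apply: ge0_le_measure_integral => //.
      + by move=> x; exact: dist_pow_ge0.
      + exact: measurable_dist_powr.
    - apply: ge0_le_measure_integral => //.
      + by move=> x; exact: dist_pow_ge0.
      + exact: measurable_dist_powr.
  move: h; rewrite gtE -!EFinM lee_fin -/D => h.
  have : (D * (1 / 2) <= D * (1 - sg))%R by rewrite ler_wpM2l//; lra.
  by lra.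
have mh (y : X) : measurable_fun setT (fun x : borel X => (mdist (x : X) y `^ p)%R).
  by apply/measurable_EFinP; exact: (measurable_dist_powr p y).
have h0 (y : X) : forall x : borel X, (0 <= mdist (x : X) y `^ p)%R.
  by move=> x; exact: powR_ge0.
have res1 : \int[marg1 s]_x dist_pow p (x : X) a <= K%:E * s setT +
    \int[mu1]_x (Num.max (mdist (x : X) a `^ p - K) 0)%:E.
  rewrite -(marg1T s).
  exact: (ge0_integral_dominated_split sle1 (mh a) (h0 a) K0).
have res2 : \int[marg2 s]_x dist_pow p (x : X) b <= K%:E * s setT +
    \int[mu2]_x (Num.max (mdist (x : X) b `^ p - K) 0)%:E.
  rewrite -(marg2T s).
  exact: (ge0_integral_dominated_split sle2 (mh b) (h0 b) K0).
have res : \int[s]_z dist_pow p z.1 z.2 <=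
    (3 `^ p * (2 * K * tau + 2 * eps + 2 * 3 `^ p * (m + C) * tau))%:E.
  apply: le_trans (integral_dist_pow_quadrangle s mdp dp0 _ cD0 quad1) _.
    exact: measurable_cst.
  rewrite EFinM; apply: lee_wpmul2l; first by rewrite lee_fin.
  have -> : \int[s]_z cst (dist_pow p a b) z = (D * sg)%:E.
    by transitivity (dist_pow p a b * s setT); [exact: integral_cst|rewrite sE].
  apply: (@le_trans _ _ ((K * sg + eps)%:E + (D * sg)%:E + (K * sg + eps)%:E)).
    apply: leeD; [apply: leeD|] => //.
    - apply: (le_trans res1); rewrite sE -EFinM EFinD.
      by rewrite leeD2l.
    - apply: (le_trans res2); rewrite sE -EFinM EFinD.
      by rewrite leeD2l.
  rewrite -!EFinD lee_fin.
  have : (K * sg <= K * tau)%R by rewrite ler_wpM2l.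
  have : (D * sg <= 2 * 3 `^ p * (m + C) * tau)%R by exact: ler_pM.
  by lra.
exists g'.
  move=> A mA; split.
    by rewrite -sum1// /marg1 /pushforward g'E.
  by rewrite -sum2// /marg2 /pushforward g'E.
rewrite (eq_measure_integral (measure_add gt s)); last first.
  by move=> A mA _; exact: etrans (g'E A) (esym (measure_addE gt s A)).
rewrite ge0_integral_measure_add// EFinD; exact: leeD.
Qed.
End coupling_repair.

(** * Entropy-transport distances *)

Section entropy_transport_theory.
Context (R : realType).
Local Open Scope ereal_scope.

Definition scaled_U1 (n : nat) (t : R) : \bar R := (n%:R * U1 t)%:E.

Lemma scaled_U1_ge0 n (t : R) : (0 <= t)%R -> 0 <= scaled_U1 n t.
Proof. by move=> t0; rewrite lee_fin mulr_ge0// U1_ge0. Qed.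

Lemma measurable_scaled_U1 n : measurable_fun [set: R] (scaled_U1 n).
Proof.
apply/measurable_EFinP; apply: measurable_funM => //; exact: measurable_U1.
Qed.

Lemma scaled_U11 n : scaled_U1 n 1 = 0.
Proof. by rewrite /scaled_U1 /U1 ln1 mulr0 add0r addNr mulr0. Qed.

Section divergence.
Context d (T : measurableType d).
Implicit Types nu mu : {finite_measure set T -> \bar R}.

Let measurable_scaled_density n nu mu : nu `<< mu -> measurable_fun [set: T]
  (fun x => scaled_U1 n (fine (Radon_Nikodym_SigmaFinite.f nu mu x))).
Proof.
move=> dom; apply: measurableT_comp; first exact: measurable_scaled_U1.
by apply: measurableT_comp => //; exact: measurable_Radon_Nikodym_SigmaFinite.
Qed.

Let density_ge0 nu mu x : nu `<< mu ->
  (0 <= fine (Radon_Nikodym_SigmaFinite.f nu mu x))%R.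
Proof. by move=> dom; rewrite fine_ge0// Radon_Nikodym_SigmaFinite.f_ge0. Qed.

Lemma F_divergence_ge0 n nu mu : 0 <= F_divergence (scaled_U1 n) nu mu.
Proof.
rewrite /F_divergence; case: asboolP => // dom; apply: integral_ge0 => x _.
by apply: scaled_U1_ge0; exact: density_ge0.
Qed.

Lemma F_divergence_le n n' nu mu : (n <= n')%N ->
  F_divergence (scaled_U1 n) nu mu <= F_divergence (scaled_U1 n') nu mu.
Proof.
move=> nn'; rewrite /F_divergence; case: asboolP => // dom.
apply: ge0_le_integral => //.
- by move=> x _; apply: scaled_U1_ge0; exact: density_ge0.
- exact: measurable_scaled_density.
- exact: measurable_scaled_density.
- move=> x _; rewrite lee_fin ler_wpM2r ?ler_nat//.
  by apply: U1_ge0; exact: density_ge0.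
Qed.

(** For [n = 0] without domination the right side would be [0 * +oo = 0], while the left side is
    [+oo]. *)
Lemma F_divergence_scale n nu mu : (0 < n)%N ->
  F_divergence (scaled_U1 n) nu mu =
  n%:R%:E * F_divergence (fun t : R => (U1 t)%:E) nu mu.
Proof.
move=> n0; rewrite /F_divergence; case: asboolP => dom; last first.
  by rewrite gt0_muley// lte_fin ltr0n.
rewrite -ge0_integralZl_EFin//.
- by move=> x _; rewrite lee_fin U1_ge0// density_ge0.
- apply/measurable_EFinP; apply: (measurableT_comp (@measurable_U1 R)).
  by apply: measurableT_comp => //; exact: measurable_Radon_Nikodym_SigmaFinite.
Qed.

Lemma F_divergence_lty F nu mu : F_divergence F nu mu < +oo -> nu `<< mu.
Proof. by rewrite /F_divergence; case: asboolP. Qed.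

End divergence.

Lemma transport_cost_ge0 (X : polishMetricType R) (p : R)
    (g : {finite_measure set borel (X * X)%type -> \bar R}) :
  0 <= \int[g]_z dist_pow p z.1 z.2.
Proof. by apply: integral_ge0 => z _; exact: dist_pow_ge0. Qed.

Lemma entropy_transport_ge0 (X : polishMetricType R) p n
    (mu1 mu2 : {finite_measure set borel X -> \bar R}) :
  0 <= entropy_transport (scaled_U1 n) (@dist_pow R X p) mu1 mu2.
Proof.
apply: le_ereal_inf_tmp => _ [g _ <-].
by apply: adde_ge0; [apply: adde_ge0; exact: F_divergence_ge0|
  exact: transport_cost_ge0].
Qed.

Lemma wasserstein_inf_ge0 (X : polishMetricType R) p
    (mu1 mu2 : {finite_measure set borel X -> \bar R}) :
  0 <= ereal_inf [set \int[g]_z dist_pow p z.1 z.2 | g in coupling mu1 mu2].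
Proof.
by apply: le_ereal_inf_tmp => _ [g _ <-]; exact: transport_cost_ge0.
Qed.

Lemma le_poweRV (p : R) (x y : \bar R) : (0 < p)%R -> 0 <= x -> x <= y ->
  x `^ p^-1 <= y `^ p^-1.
Proof.
move=> p0 x0 xy; apply: gt0_ler_poweR => //.
- by rewrite invr_ge0 ltW.
- by rewrite in_itv/= x0 leey.
- by rewrite in_itv/= (le_trans x0 xy) leey.
Qed.

Lemma ET_distance_le (X : polishMetricType R) p n n'
    (mu1 mu2 : {finite_measure set borel X -> \bar R}) : (0 < p)%R ->
  (n <= n')%N -> ET_distance p n mu1 mu2 <= ET_distance p n' mu1 mu2.
Proof.
move=> p0 nn'; apply: le_poweRV => //; first exact: entropy_transport_ge0.
apply: le_ereal_inf_tmp => _ [g _ <-].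
apply: ge_ereal_inf; eexists; first by exists g.
by rewrite leeD2r// leeD// F_divergence_le.
Qed.

Lemma ET_distance_eq (X : polishMetricType R) p n
    (mu1 mu1' mu2 mu2' : {finite_measure set borel X -> \bar R}) :
  (forall A, measurable A -> mu1 A = mu1' A) ->
  (forall A, measurable A -> mu2 A = mu2' A) ->
  ET_distance p n mu1 mu2 = ET_distance p n mu1' mu2'.
Proof.
move=> eq1 eq2; rewrite /ET_distance /entropy_transport; congr (ereal_inf _ `^ _).
apply: eq_imagel => g _; congr (_ + _ + _).
- apply: eq_F_divergence => //; first exact: scaled_U1_ge0.
  exact: measurable_scaled_U1.
- apply: eq_F_divergence => //; first exact: scaled_U1_ge0.
  exact: measurable_scaled_U1.
Qed.

Lemma ET_distance_le_wasserstein (X : polishMetricType R) p n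
    (mu1 mu2 : {finite_measure set borel X -> \bar R}) : (0 < p)%R ->
  ET_distance p n mu1 mu2 <= wasserstein p mu1 mu2.
Proof.
move=> p0; apply: le_poweRV => //; first exact: entropy_transport_ge0.
apply: le_ereal_inf_tmp => _ [g gc <-].
apply: ge_ereal_inf; eexists; first by exists g.
rewrite !F_divergence_self ?add0e//.
- exact: scaled_U1_ge0.
- exact: measurable_scaled_U1.
- exact: scaled_U11.
- by move=> A mA; exact: (gc A mA).2.
- exact: scaled_U1_ge0.
- exact: measurable_scaled_U1.
- exact: scaled_U11.
- by move=> A mA; exact: (gc A mA).1.
Qed.

Implicit Types M : mmspace R.

Lemma sturm_ET_distance_ge0 p n M1 M2 : 0 <= sturm_ET_distance p n M1 M2.
Proof.
by apply: le_ereal_inf_tmp => _ [Y [psi1 [psi2 ->]]]; exact: poweR_ge0.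
Qed.

Lemma sturm_ET_distance_nondecreasing p M1 M2 : (0 < p)%R ->
  nondecreasing_seq (fun n => sturm_ET_distance p n M1 M2).
Proof.
move=> p0 n n' nn'; apply: le_ereal_inf_tmp => _ [Y [psi1 [psi2 ->]]].
apply: ge_ereal_inf; eexists; first by exists Y, psi1, psi2.
exact: ET_distance_le.
Qed.

Lemma limit_ET_distanceE p M1 M2 : (0 < p)%R -> limit_ET_distance p M1 M2 =
  ereal_sup (range (fun n => sturm_ET_distance p n M1 M2)).
Proof.
move=> p0; apply/cvg_lim => //.
by apply: ereal_nondecreasing_cvgn; exact: sturm_ET_distance_nondecreasing.
Qed.

End entropy_transport_theory.

(** * Invariance under isomorphism of metric measure spaces *)

Section isomorphism.
Context (R : realType).
Implicit Types M : mmspace R.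
Local Open Scope ereal_scope.

(** The range condition provides preimages of the points of the second support, and an isometry is
    injective, so choosing preimages inverts [psi]. Symmetry lets the inequality of
    [sturm_ET_distance_iso] be used in both directions. *)
Lemma mm_isomorphic_sym M1 M2 : mm_isomorphic M1 M2 -> mm_isomorphic M2 M1.
Proof.
move=> [psi [rpsi mpsi]].
have inv (y : supp (mm_measure M2)) :
    exists x : supp (mm_measure M1), psi x = set_val y.
  have [x _ xy] : range psi (set_val y) by rewrite rpsi; exact: set_valP.
  by exists x.
pose q y := sval (cid (inv y)).
have qE y : psi (q y) = set_val y by rewrite /q; case: cid.
have qiso x y : mdist (set_val (q x)) (set_val (q y)) = mdist (set_val x) (set_val y).
  by rewrite -!qE embedding_isometry.
pose phi := @IsometricEmbedding _ _ M1 (supp (mm_measure M2)) (set_val \o q) qiso.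
have psi_inj x x' : psi x = psi x' -> x = x'.
  move=> xx'; apply: val_inj; apply: mdist_positivity.
  by rewrite -[LHS](embedding_isometry psi) xx' mdistxx.
have psi_supp x : supp (mm_measure M2) (psi x) by rewrite -rpsi; exists x.
exists phi; split.
  apply/seteqP; split => [_ [y _ <-]|x Sx]; first exact: set_valP.
  exists (SigSub (mem_set (psi_supp (SigSub (mem_set Sx))))) => //.
  by rewrite /phi/= (_ : q _ = SigSub (mem_set Sx))//; apply: psi_inj; rewrite qE.
move=> B mB; have mphiB : measurable (set_val @` (phi @^-1` B) : set (borel M2)).
  by apply: measurable_embedding => //; exact: supp_closed.
(* Writing the left side as an [M1]-measure through [mpsi] and cutting [B] down to the support
   reduces the claim to an equality of sets. *)
rewrite -measureI_supp// -[LHS]/(mm_measure M2 _) -mpsi//.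
congr (mm_measure M1 _); apply/seteqP; split => [_ [x [y By yx] <-]|x [Bx Sx]].
  split; last exact: set_valP.
  by rewrite -(psi_inj (q y) x)// qE.
pose x' : supp (mm_measure M1) := SigSub (mem_set Sx).
exists x' => //; exists (SigSub (mem_set (psi_supp x'))) => //.
by rewrite /preimage/= (_ : q _ = x')//; apply: psi_inj; rewrite qE.
Qed.

(** Composing an embedding of the primed support with the isomorphism embeds the unprimed one with
    the same push-forward, so every value on the right is also attained on the left. *)
Lemma sturm_ET_distance_iso p n M1 M1' M2 M2' :
  mm_isomorphic M1 M1' -> mm_isomorphic M2 M2' ->
  sturm_ET_distance p n M1 M2 <= sturm_ET_distance p n M1' M2'.
Proof.
have pull M M' (Y : polishMetricType R)
    (psi' : isometric_embedding Y (supp (mm_measure M'))) : mm_isomorphic M M' ->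
    exists psi : isometric_embedding Y (supp (mm_measure M)),
      forall A, measurable A -> supp_pushforward psi A = supp_pushforward psi' A.
  move=> [f [rf mf]].
  have f_supp x : supp (mm_measure M') (f x) by rewrite -rf; exists x.
  pose h x := psi' (SigSub (mem_set (f_supp x))).
  have hiso x y : mdist (h x) (h y) = mdist (set_val x) (set_val y).
    by rewrite /h embedding_isometry -(embedding_isometry f).
  exists (IsometricEmbedding hiso) => A mA.
  have mpre : measurable (set_val @` (psi' @^-1` A) : set (borel M')).
    by apply: measurable_embedding => //; exact: supp_closed.
  rewrite /supp_pushforward -mf//; congr (mm_measure M _).
  apply/seteqP; split => _ [x Ax <-]; exists x => //.
    by exists (SigSub (mem_set (f_supp x))).
  case: Ax => y Ay yx.
  by rewrite /preimage/= /h (_ : SigSub _ = y)//; exact: val_inj.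
move=> iso1 iso2; apply: le_ereal_inf_tmp => _ [Y [psi1' [psi2' ->]]].
have [psi1 eq1] := pull _ _ _ psi1' iso1.
have [psi2 eq2] := pull _ _ _ psi2' iso2.
apply: ge_ereal_inf; eexists; first by exists Y, psi1, psi2.
by rewrite (ET_distance_eq p n eq1 eq2).
Qed.

Lemma limit_ET_distance_iso p M1 M1' M2 M2' :
  mm_isomorphic M1 M1' -> mm_isomorphic M2 M2' ->
  limit_ET_distance p M1 M2 = limit_ET_distance p M1' M2'.
Proof.
move=> iso1 iso2; rewrite /limit_ET_distance; congr (limn _).
apply/funext => n; apply/eqP; rewrite eq_le !sturm_ET_distance_iso//;
  exact: mm_isomorphic_sym.
Qed.

End isomorphism.

(** * Comparison of the limit with Sturm's distance *)

Section limit_of_ET_distances.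
Context (R : realType).
Implicit Types M : mmspace R.
Local Open Scope ereal_scope.

(** The base point is moved into the support, the only place where embeddings are defined; a measure
    of mass one has nonempty support. *)
Lemma prob_moment_supp p M : (0 < p)%R -> mm_prob_moment p M ->
  exists2 a : supp (mm_measure M), True &
    \int[mm_measure M]_x dist_pow p (x : M) (set_val a) < +oo.
Proof.
move=> p0 [muT [x0 mom]].
have [a Sa] : supp (mm_measure M) !=set0.
  apply/set0P/eqP => S0; have := supp_full (mm_measure M).
  by rewrite S0 setC0 muT => /eqP; rewrite onee_eq0.
exists (SigSub (mem_set Sa)) => //.
pose c := (3 `^ p)%:E * dist_pow p x0 a.
have c0 : 0 <= (3 `^ p)%:E by rewrite lee_fin powR_ge0.
have m0 := measurable_dist_powr p x0.
have ma := measurable_dist_powr p a.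
apply: (@le_lt_trans _ _ (\int[mm_measure M]_x ((3 `^ p)%:E *
    (dist_pow p (x : M) x0 + cst (dist_pow p x0 a) x)))).
  apply: ge0_le_integral => //.
  - by move=> x _; exact: dist_pow_ge0.
  - by apply: measurable_funeM; exact: emeasurable_funD.
  (* The quadrangle inequality degenerates to a triangle: its last term is d(a,a)^p, which is 0
     because [p] is positive. *)
  - move=> x _ /=; apply: le_trans (dist_pow_quadrangle (x : M) a x0 a p0) _.
    by rewrite [X in _ + X](_ : _ = 0) ?adde0// /dist_pow mdistxx powR0 ?gt_eqF.
rewrite ge0_integralZl//; last 2 first.
- exact: emeasurable_funD.
- by move=> x _; apply: adde_ge0; exact: dist_pow_ge0.
rewrite ge0_integralD//; last 2 first.
- by move=> x _; exact: dist_pow_ge0.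
- by move=> x _; exact: dist_pow_ge0.
apply: lte_mul_pinfty => //; apply: lte_add_pinfty => //.
rewrite integral_cst//; apply: lte_mul_pinfty; rewrite ?dist_pow_ge0//.
by rewrite -[X in X < _]/(mm_measure M setT) muT ltry.
Qed.

(** The order of quantifiers is the point: [n] is fixed before the ambient space. Every constant is
    computed from moments and tails of the original measures at points of their supports, and
    isometric embeddings preserve these. *)
Lemma coupling_of_entropy_plan (p : R) M1 M2 (C eta : R) : (0 < p)%R ->
  mm_prob_moment p M1 -> mm_prob_moment p M2 -> (0 <= C)%R -> (0 < eta)%R ->
  exists n, forall (Y : polishMetricType R)
    (psi1 : isometric_embedding Y (supp (mm_measure M1)))
    (psi2 : isometric_embedding Y (supp (mm_measure M2))),
    let mu1 := supp_pushforward psi1 in let mu2 := supp_pushforward psi2 in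
    entropy_transport (scaled_U1 n) (@dist_pow R Y p) mu1 mu2 < C%:E ->
    ereal_inf [set \int[g]_z dist_pow p z.1 z.2 | g in coupling mu1 mu2]
      <= (C + eta)%:E.
Proof.
move=> p0 pm1 pm2 C0 eta0.
have [a _ ma] := prob_moment_supp p0 pm1.
have [b _ mb] := prob_moment_supp p0 pm2.
have [mu1T _] := pm1; have [mu2T _] := pm2.
pose c := (3 `^ p)%R; have c0 : (0 < c)%R by rewrite powR_gt0.
have meas M (x0 : M) :
    measurable_fun setT (fun x : borel M => (mdist (x : M) x0 `^ p)%R).
  by apply/measurable_EFinP; exact: (measurable_dist_powr p x0).
(* Chosen so that the tail contribution [c * (2 * eps)] is exactly [eta / 2]. *)
pose eps := (eta / (4 * c))%R.
have eps0 : (0 < eps)%R by rewrite divr_gt0// mulr_gt0.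
have [K1 K10 tail1] := integral_tail (meas M1 (set_val a))
  (fun x => powR_ge0 _ _) ma eps0.
have [K2 K20 tail2] := integral_tail (meas M2 (set_val b))
  (fun x => powR_ge0 _ _) mb eps0.
pose K := Num.max K1 K2.
have K0 : (0 <= K)%R by rewrite le_max K10.
have tailK M (x0 : M) (K' : R) : (K' <= K)%R ->
    \int[mm_measure M]_x (Num.max (mdist (x : M) x0 `^ p - K') 0)%:E <= eps%:E ->
    \int[mm_measure M]_x (Num.max (mdist (x : M) x0 `^ p - K) 0)%:E <= eps%:E.
  move=> K'K; apply: le_trans; apply: ge0_le_integral => //.
  - by move=> x _; rewrite lee_fin le_max lexx orbT.
  - apply/measurable_EFinP; apply: measurable_maxr => //.
    by apply: measurable_funB => //; exact: meas.
  - apply/measurable_EFinP; apply: measurable_maxr => //.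
    by apply: measurable_funB => //; exact: meas.
  - by move=> x _; rewrite lee_fin ge_max !le_max lexx orbT andbT lerB.
have {}tail1 : \int[mm_measure M1]_x
    (Num.max (mdist (x : M1) (set_val a) `^ p - K) 0)%:E <= eps%:E.
  by apply: tailK tail1; rewrite le_max lexx.
have {}tail2 : \int[mm_measure M2]_x
    (Num.max (mdist (x : M2) (set_val b) `^ p - K) 0)%:E <= eps%:E.
  by apply: tailK tail2; rewrite le_max lexx orbT.
pose m := fine (\int[mm_measure M1]_x dist_pow p (x : M1) (set_val a) +
  \int[mm_measure M2]_x dist_pow p (x : M2) (set_val b)).
have I10 : 0 <= \int[mm_measure M1]_x dist_pow p (x : M1) (set_val a).
  by apply: integral_ge0 => x _; exact: dist_pow_ge0.
have I20 : 0 <= \int[mm_measure M2]_x dist_pow p (x : M2) (set_val b).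
  by apply: integral_ge0 => x _; exact: dist_pow_ge0.
have mE : \int[mm_measure M1]_x dist_pow p (x : M1) (set_val a) +
  \int[mm_measure M2]_x dist_pow p (x : M2) (set_val b) = m%:E.
  apply/esym/fineK; rewrite ge0_fin_numE; last exact: adde_ge0.
  by apply: lte_add_pinfty; [exact: ma|exact: mb].
have m0 : (0 <= m)%R by rewrite fine_ge0// adde_ge0.
pose Q := (2 * K + 2 * c * (m + C))%R.
have Q0 : (0 <= Q)%R.
  by rewrite addr_ge0// !mulr_ge0// ?addr_ge0//; exact: ltW.
(* The cap 1/2 is demanded by [coupling_repair]. The second bound gives [c * Q * tau <= eta / 2],
   with [Q + 1] in place of [Q] to keep the denominator positive. *)
pose tau := Num.min (1 / 2)%R (eta / (2 * c * (Q + 1)))%R.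
have tau0 : (0 < tau)%R.
  by rewrite lt_min !divr_gt0// ?mulr_gt0//; lra.
have tau2 : (tau <= 1 / 2)%R by rewrite ge_min lexx.
have tauQ : (c * Q * tau <= eta / 2)%R.
  apply: (@le_trans _ _ (c * (Q + 1) * (eta / (2 * c * (Q + 1))))%R).
    apply: ler_pM; rewrite ?mulr_ge0//; try exact: ltW.
    - by rewrite ler_pM2l//; lra.
    - by rewrite ge_min lexx orbT.
  suff -> : (c * (Q + 1) * (eta / (2 * c * (Q + 1))) = eta / 2)%R by [].
  by field; rewrite !gt_eqF//; lra.
pose dl := (tau / 4)%R.
have dl01 : (0 < dl < 1)%R by rewrite /dl; apply/andP; split; lra.
(* With [dl = tau / 4] the term [2 * dl] takes half of [tau]. The entropy term [2 / dl * (C / n)] is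
   [8 * C / (tau * n)], which fits in the other half once [n] reaches [16 * C / tau ^+ 2]. *)
pose n := Num.bound (16 * C / tau ^+ 2)%R.
have nC : (16 * C / tau ^+ 2 < n.+1%:R)%R.
  apply: lt_trans (archi_boundP _) _; last by rewrite ltr_nat.
  by rewrite divr_ge0 ?sqr_ge0// mulr_ge0.
have n0 : (0 < n.+1%:R :> R)%R by [].
have dle : (2 * dl + 2 / dl * (C / n.+1%:R) <= tau)%R.
  have : (2 / dl * (C / n.+1%:R) <= tau / 2)%R.
    have -> : (2 / dl * (C / n.+1%:R) = (16 * C / tau ^+ 2) * (tau / 2) / n.+1%:R)%R.
      by rewrite /dl; field; rewrite !gt_eqF.
    rewrite ler_pdivrMr// [leRHS]mulrC ler_pM2r ?divr_gt0//; exact: ltW.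
  rewrite (_ : (2 * dl = tau / 2)%R); last by rewrite /dl; lra.
  by move=> h; rewrite [leRHS](splitr tau) lerD.
exists n.+1 => Y psi1 psi2 mu1 mu2 /ereal_inf_lt[_ [g _ <-]].
rewrite !F_divergence_scale// => gC.
set E1 := F_divergence _ (marg1 g) mu1 in gC.
set E2 := F_divergence _ (marg2 g) mu2 in gC.
have E10 : 0 <= E1 by exact: F_divergence_U1_ge0.
have E20 : 0 <= E2 by exact: F_divergence_U1_ge0.
have J0 := transport_cost_ge0 p g.
have EC : n.+1%:R%:E * (E1 + E2) <= C%:E.
  by rewrite ge0_muleDr//; apply: le_trans (ltW gC); rewrite leeDl.
have EC' : E1 + E2 <= (C / n.+1%:R)%:E.
  by rewrite EFinM lee_pdivlMr// muleC.
have Elty : E1 + E2 < +oo by apply: le_lt_trans EC' _; rewrite ltry.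
have dom1 : marg1 g `<< mu1.
  have /F_divergence_lty// : E1 < +oo by apply: le_lt_trans Elty; rewrite leeDl.
have dom2 : marg2 g `<< mu2.
  have /F_divergence_lty// : E2 < +oo by apply: le_lt_trans Elty; rewrite leeDr.
have gC' : \int[g]_z dist_pow p z.1 z.2 <= C%:E.
  apply: le_trans (ltW gC); rewrite leeDr// adde_ge0//.
  - by rewrite mule_ge0.
  - by rewrite mule_ge0.
have [g' g'c g'le] : exists2 g', coupling mu1 mu2 g' &
    \int[g']_z dist_pow p z.1 z.2 <= (C + 3 `^ p * (2 * K * tau + 2 * eps
      + 2 * 3 `^ p * (m + C) * tau))%:E.
  (* Functions of the distance to a base point integrate alike before and after embedding. The
     identity gives the moments and the excess over [K] gives the tails. *)
  have push M (psi : isometric_embedding Y (supp (mm_measure M)))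
      (x0 : supp (mm_measure M)) (f : R -> R) :
      measurable_fun setT f -> (forall r, (0 <= r)%R -> (0 <= f r)%R) ->
      \int[supp_pushforward psi]_y (f (mdist (y : Y) (psi x0) `^ p)%R)%:E =
      \int[mm_measure M]_x (f (mdist (x : M) (set_val x0) `^ p)%R)%:E.
    move=> mf f0; apply: integral_supp_pushforward => [|y||x|x].
    - apply/measurable_EFinP; apply: measurableT_comp => //.
      by apply/measurable_EFinP; exact: (measurable_dist_powr p (psi x0)).
    - by rewrite lee_fin f0// powR_ge0.
    - by apply/measurable_EFinP; apply: measurableT_comp => //; exact: meas.
    - by rewrite lee_fin f0// powR_ge0.
    - by rewrite embedding_isometry.
  have mmax : measurable_fun [set: R] (fun r => Num.max (r - K) 0)%R.
    by apply: measurable_maxr => //; exact: measurable_funB.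
  have max0 (r : R) : (0 <= r -> 0 <= Num.max (r - K) 0)%R.
    by rewrite le_max lexx orbT.
  apply: (@coupling_repair _ _ p (psi1 a) (psi2 b) m C K eps tau dl
    (C / n.+1%:R) g mu1 mu2) => //.
  - by rewrite -mu1T; exact: supp_pushforwardT.
  - by rewrite -mu2T; exact: supp_pushforwardT.
  - by rewrite -mE; apply: leeD;
      [rewrite (push _ psi1 a id)|rewrite (push _ psi2 b id)].
  - by rewrite (push _ psi1 a (fun r => Num.max (r - K) 0)%R).
  - by rewrite (push _ psi2 b (fun r => Num.max (r - K) 0)%R).
apply: ge_ereal_inf; exists (\int[g']_z dist_pow p z.1 z.2); first by exists g'.
apply: le_trans g'le _; rewrite lee_fin lerD2l -/c.
have : (c * (2 * eps) = eta / 2)%R.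
  by rewrite /eps; field; rewrite gt_eqF.
move: tauQ; rewrite /Q; lra.
Qed.

Lemma sturm_distance_le_limit_ET p M1 M2 : (0 < p)%R ->
  mm_prob_moment p M1 -> mm_prob_moment p M2 ->
  sturm_distance p M1 M2 <= limit_ET_distance p M1 M2.
Proof.
move=> p0 pm1 pm2.
have ETlim n : sturm_ET_distance p n M1 M2 <= limit_ET_distance p M1 M2.
  by rewrite limit_ET_distanceE//; apply: ereal_sup_ubound; exists n.
have lim0 := le_trans (sturm_ET_distance_ge0 p 0 M1 M2) (ETlim 0%N).
move: ETlim lim0; case: (limit_ET_distance p M1 M2) => [l| |] // ETlim l0; last first.
  by rewrite leey.
rewrite lee_fin in l0; apply/lee_addgt0Pr => e e0.
have e2 : (0 < e / 2)%R by rewrite divr_gt0.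
have pV0 : (0 <= p^-1)%R by rewrite invr_ge0 ltW.
(* Raising to the power [p] passes from distances to costs. The room between [l + e / 2] and [l + e]
   becomes the tolerance [C2 - C1] for the repaired coupling. *)
pose C1 := ((l + e / 2) `^ p)%R; pose C2 := ((l + e) `^ p)%R.
have root (r : R) : (0 <= r)%R -> (r `^ p)%:E `^ p^-1 = r%:E.
  by move=> r0; rewrite poweR_EFin -powRrM mulfV ?gt_eqF// powRr1.
have C12 : (0 < C2 - C1)%R.
  by rewrite subr_gt0; apply: gt0_ltr_powR; rewrite ?nnegrE; lra.
have [n repair] := coupling_of_entropy_plan p0 pm1 pm2 (powR_ge0 _ _ : 0 <= C1)%R C12.
have : sturm_ET_distance p n M1 M2 < (l + e / 2)%:E.
  by apply: le_lt_trans (ETlim n) _; rewrite lte_fin ltrDl.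
move=> /ereal_inf_lt[_ [Y [psi1 [psi2 ->]]] ETlt].
have /repair : entropy_transport (scaled_U1 n) (@dist_pow R Y p)
    (supp_pushforward psi1) (supp_pushforward psi2) < C1%:E.
  (* By contraposition: a cost of at least [C1] would have a root of at least [l + e / 2]. *)
  rewrite ltNge; apply/negP => C1le; move: ETlt; rewrite ltNge => /negP; apply.
  rewrite -root; last by lra.
  by apply: le_poweRV => //; rewrite lee_fin powR_ge0.
rewrite addrC subrK => W.
apply: ge_ereal_inf; eexists.
  by exists Y, psi1, psi2.
rewrite -EFinD -root; last by lra.
by apply: le_poweRV => //; exact: wasserstein_inf_ge0.
Qed.

Lemma limit_ET_le_sturm_distance p M1 M2 : (0 < p)%R ->
  limit_ET_distance p M1 M2 <= sturm_distance p M1 M2.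
Proof.
move=> p0; rewrite limit_ET_distanceE//; apply: ge_ereal_sup => _ [n _ <-].
apply: le_ereal_inf_tmp => _ [Y [psi1 [psi2 ->]]].
apply: ge_ereal_inf; eexists; first by exists Y, psi1, psi2.
exact: ET_distance_le_wasserstein.
Qed.

End limit_of_ET_distances.

Theorem theorem7 (R : realType) (p : R) (hp : 1 <= p) :
  [/\ (forall M1 M2 : mmspace R,
         cvgn (fun n => sturm_ET_distance p n M1 M2) /\
         (0 <= limit_ET_distance p M1 M2)%E),
      (forall M1 M1' M2 M2' : mmspace R,
         mm_isomorphic M1 M1' -> mm_isomorphic M2 M2' ->
         limit_ET_distance p M1 M2 = limit_ET_distance p M1' M2') &
      (forall M1 M2 : mmspace R,
         mm_prob_moment p M1 -> mm_prob_moment p M2 ->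
         limit_ET_distance p M1 M2 = sturm_distance p M1 M2)].
Proof.
have p0 : 0 < p by lra.
split.
- move=> M1 M2; have ndET := sturm_ET_distance_nondecreasing M1 M2 p0.
  split; first exact: ereal_nondecreasing_is_cvgn.
  apply: lime_ge; first exact: ereal_nondecreasing_is_cvgn.
  by apply: nearW => n; exact: sturm_ET_distance_ge0.
- by move=> M1 M1' M2 M2'; exact: limit_ET_distance_iso.
- move=> M1 M2 pm1 pm2; apply/eqP; rewrite eq_le limit_ET_le_sturm_distance//=.
  exact: sturm_distance_le_limit_ET.
Qed.
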